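(* $SU_q(2)$ admits an equivariant odd $3$-summable spectral triple; that is, there is an equivariant self-adjoint operator $D$ on $\mathcal{H}$ such that $(\mathcal{A},\mathcal{H},D)$ is an odd spectral triple which is $3$-summable.
   Context: Fix a real number $q\in(0,1)$. $\mathcal{A}=C(SU_q(2))$ is the $C^*$-algebra generated by $\alpha,\beta$ subject to $\alpha^*\alpha+\beta^*\beta=I$, $\alpha\alpha^*+q^2\beta\beta^*=I$, $\alpha\beta-q\beta\alpha=0$, $\alpha\beta^*-q\beta^*\alpha=0$, $\beta^*\beta=\beta\beta^*$; $\mathcal{A}_f$ is the dense $*$-subalgebra generated by $\alpha,\beta$. $\mathcal{H}$ is the GNS space of the (faithful) Haar state of $\mathcal{A}$. It has an orthonormal basis $\{e^{(n)}_{ij}: n=0,\frac12,1,\ldots;\ i,j=-n,-n+1,\ldots,n\}$ (normalized matrix entries of the irreducible representations), and $\mathcal{A}$ acts faithfully on $\mathcal{H}$ by $$\alpha e^{(n)}_{ij}=a_+(n,i,j)e^{(n+1/2)}_{i-1/2,j-1/2}+a_-(n,i,j)e^{(n-1/2)}_{i-1/2,j-1/2},\quad \beta e^{(n)}_{ij}=b_+(n,i,j)e^{(n+1/2)}_{i+1/2,j-1/2}+b_-(n,i,j)e^{(n-1/2)}_{i+1/2,j-1/2},$$ $$a_+=\Bigl(q^{2(n+i)+2(n+j)+2}\tfrac{(1-q^{2n-2j+2})(1-q^{2n-2i+2})}{(1-q^{4n+2})(1-q^{4n+4})}\Bigr)^{1/2},\quad a_-=\Bigl(\tfrac{(1-q^{2n+2j})(1-q^{2n+2i})}{(1-q^{4n})(1-q^{4n+2})}\Bigr)^{1/2},$$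 $$b_+=-\Bigl(q^{2(n+j)}\tfrac{(1-q^{2n-2j+2})(1-q^{2n+2i+2})}{(1-q^{4n+2})(1-q^{4n+4})}\Bigr)^{1/2},\quad b_-=\Bigl(q^{2(n+i)}\tfrac{(1-q^{2n+2j})(1-q^{2n-2i})}{(1-q^{4n})(1-q^{4n+2})}\Bigr)^{1/2},$$ where terms involving basis vectors with indices out of range are zero. Odd spectral triple: $(\mathcal{A},\mathcal{H},D)$ is an odd spectral triple if $D$ is self-adjoint on $\mathcal{H}$, has compact resolvent, and $[D,a]$ is bounded for all $a\in\mathcal{A}_f$. Equivariance: let $A_0 e^{(n)}_{ij}=q^je^{(n)}_{ij}$, and $A_1e^{(n)}_{ij}=(q^{-2n}+q^{2n+2}-q^{-2j}-q^{2j+2})^{1/2}e^{(n)}_{i,j+1}$ if $j<n$, $A_1e^{(n)}_{in}=0$. An operator is equivariant if it commutes with $A_0,A_1,A_1^*$. The spectral triple is equivariant if $D$ is. $p$-summability: $D$ is $p$-summable if $|D|^{-p}$ (inverse taken on the orthogonal complement of the finite-dimensional kernel) lies in $\mathcal{L}^{(1,\infty)}$, the ideal of compact operators whose singular values $\mu_1\ge\mu_2\ge\cdots$ satisfy $\sum_{k=1}^N\mu_k=O(\log N)$. *)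

(* Defs.v *)
From HB Require Import structures.
From mathcomp Require Import all_boot all_order all_algebra.
From mathcomp Require Import all_classical all_reals all_analysis.
From mathcomp Require Import complex ring.

Set Implicit Arguments.
Unset Strict Implicit.
Unset Printing Implicit Defensive.

Import Order.TTheory GRing.Theory Num.Theory numFieldNormedType.Exports.
Import ComplexField.Normc ComplexField.
Local Open Scope classical_set_scope.
Local Open Scope ring_scope.

Definition square_summable (R : realType) (I : choiceType) (x : I -> R[i]^o)
  : Prop :=
  (\esum_(s in [set: I]) (normc (x s) ^+ 2)%:E < +oo)%E.

Definition ell2_pred (R : realType) (I : choiceType) : {pred I -> R[i]^o} :=
  [pred x | `[< square_summable x >]].

Section ell2_submod.
Variables (R : realType) (I : choiceType).
Implicit Types x y : I -> R[i]^o.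

Lemma normc_ge0 (z : R[i]) : 0 <= normc z.
Proof. by case: z => u v; exact: sqrtr_ge0. Qed.

Lemma square_summable_finite x :
  finite_set [set s | x s != 0] -> square_summable x.
Proof.
move=> fx; rewrite /square_summable.
have -> : \esum_(s in [set: I]) (normc (x s) ^+ 2)%:E
    = \esum_(s in [set s | x s != 0]) (normc (x s) ^+ 2)%:E.
  rewrite [RHS]esum_mkcond; apply: eq_esum => s _.
  case: ifPn => // /negP; rewrite inE /= => /negP; rewrite negbK => /eqP ->.
  by rewrite normc0 expr0n.
rewrite esum_fset //; last by move=> s _; rewrite lee_fin sqr_ge0.
by rewrite fsumEFin // ltry.
Qed.

Lemma square_summableZ (a : R[i]) x :
  square_summable x -> square_summable (a *: x).
Proof.
rewrite /square_summable => hx.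
have nn s : (0 <= (normc (x s) ^+ 2)%:E)%E by rewrite lee_fin sqr_ge0.
apply: (@le_lt_trans _ _ ((normc a ^+ 2)%:E
  * \esum_(s in [set: I]) (normc (x s) ^+ 2)%:E)%E); last first.
  by rewrite lte_mul_pinfty ?lee_fin ?sqr_ge0.
apply: ge_ereal_sup => _ [X [finX XI] <-].
have -> : \sum_(s \in X) (normc ((a *: x) s) ^+ 2)%:E
    = ((normc a ^+ 2)%:E * \sum_(s \in X) (normc (x s) ^+ 2)%:E)%E.
  rewrite ge0_mule_fsumr //; apply: eq_fsbigr => s _.
  by rewrite -EFinM -exprMn -normcM.
by apply: lee_wpmul2l; rewrite ?lee_fin ?sqr_ge0 // esum_ge //; exists X.
Qed.

Lemma square_summableD x y :
  square_summable x -> square_summable y -> square_summable (x + y).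
Proof.
move=> hx hy; rewrite /square_summable.
have r2 : (0 : R) <= 2 by [].
have nn (z : I -> R[i]^o) s : (0 <= (normc (z s) ^+ 2)%:E)%E.
  by rewrite lee_fin sqr_ge0.
set c : R[i] := (Num.sqrt 2)%:C%C.
have nc z : normc (c * z) ^+ 2 = 2 * normc z ^+ 2.
  by rewrite normcM exprMn /= expr0n /= addr0 sqrtr_sqr ger0_norm ?sqrtr_ge0 //
    sqr_sqrtr.
apply: (@le_lt_trans _ _ (\esum_(s in [set: I])
    ((normc ((c *: x) s) ^+ 2)%:E + (normc ((c *: y) s) ^+ 2)%:E))%E); last first.
  by rewrite esumD //; apply: lte_add_pinfty; exact: square_summableZ.
apply: le_esum => s _; rewrite -EFinD lee_fin.
rewrite (_ : (c *: x) s = c * x s) // (_ : (c *: y) s = c * y s) // !nc.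
apply: (@le_trans _ _ ((normc (x s) + normc (y s)) ^+ 2)).
  by rewrite lerXn2r ?nnegrE ?addr_ge0 ?normc_ge0 //; exact: le_normcD.
rewrite -subr_ge0; have := sqr_ge0 (normc (x s) - normc (y s)).
by congr (_ <= _); ring.
Qed.

Lemma ell2_submod_closed : submod_closed (@ell2_pred R I).
Proof.
split.
  rewrite inE; apply/asboolP; apply/asboolP.
  apply: (@square_summable_finite (fun=> 0)).
  rewrite (_ : [set _ | _] = set0) //.
  by apply/seteqP; split => s //=; rewrite eqxx.
move=> a x y; rewrite !inE => /asboolP/asboolP hx /asboolP/asboolP hy.
apply/asboolP; apply/asboolP.
by apply: square_summableD => //; exact: square_summableZ.
Qed.

HB.instance Definition _ :=
  GRing.isSubmodClosed.Build R[i] (I -> R[i]^o) (@ell2_pred R I)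
    ell2_submod_closed.

Record ell2 := Ell2 { coord :> I -> R[i]^o; _ : coord \in @ell2_pred R I }.

HB.instance Definition _ := [isSub for coord].
HB.instance Definition _ := [Choice of ell2 by <:].
HB.instance Definition _ := [SubChoice_isSubLmodule of ell2 by <:].

End ell2_submod.

Section hilbert_space.
Variables (R : realType) (I : choiceType).

Definition real_sum (f : I -> R) : R :=
  fine (\esum_(s in [set: I]) (EFin \o f)^\+ s
        - \esum_(s in [set: I]) (EFin \o f)^\- s)%E.

(* Sum of an absolutely summable complex family. *)
Definition complex_sum (f : I -> R[i]) : R[i] :=
  (real_sum (fun s => complex.Re (f s)) +i* real_sum (fun s => complex.Im (f s)))%C.

Definition inner (x y : ell2 R I) : R[i] :=
  complex_sum (fun s => x s * (y s)^*%C).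

Definition hnorm (x : ell2 R I) : R := Num.sqrt (complex.Re (inner x x)).

Definition hcvg (x : nat -> ell2 R I) (y : ell2 R I) : Prop :=
  hnorm (x k - y) @[k --> \oo] --> (0 : R).

Definition orthonormal (u : nat -> ell2 R I) : Prop :=
  forall k l, inner (u k) (u l) = (k == l)%:R.

End hilbert_space.

(* Unbounded operators are identified with their graphs. *)

Notation graph R I := (set (ell2 R I * ell2 R I)).

Section operators.
Variables (R : realType) (I : choiceType).
Local Notation H := (ell2 R I).
Implicit Types (S T D A : graph R I) (z : R[i]).

Definition dom T : set H := [set x | exists y, T (x, y)].

Definition linear_operator T : Prop :=
  [/\ T (0, 0),
      (forall z x y x' y', T (x, y) -> T (x', y') ->
         T (z *: x + x', z *: y + y')) &
      (forall x y y', T (x, y) -> T (x, y') -> y = y')].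

Definition op_id : graph R I := [set p | p.2 = p.1].

Definition op_scale z T : graph R I :=
  [set p | exists2 y, T (p.1, y) & p.2 = z *: y].

Definition op_add S T : graph R I :=
  [set p | exists y y', [/\ S (p.1, y), T (p.1, y') & p.2 = y + y']].

Definition op_comp S T : graph R I :=
  [set p | exists2 y, T (p.1, y) & S (y, p.2)].

Definition op_inv T : graph R I := [set p | T (p.2, p.1)].

Definition op_adj T : graph R I :=
  [set p | forall x y, T (x, y) -> inner y p.1 = inner x p.2].

Definition op_pow T (p : nat) : graph R I := iter p (op_comp T) op_id.

Definition op_commutator S T : graph R I :=
  op_add (op_comp S T) (op_scale (-1) (op_comp T S)).

Definition densely_defined T : Prop :=
  forall (x : H) (e : R), 0 < e -> exists2 y, dom T y & hnorm (x - y) < e.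

Definition self_adjoint T : Prop :=
  [/\ linear_operator T, densely_defined T & op_adj T = T].

Definition positive T : Prop :=
  self_adjoint T /\ forall x y, T (x, y) -> 0 <= inner y x.

Definition norm_bounded T : Prop :=
  exists C : R, forall x y, T (x, y) -> hnorm y <= C * hnorm x.

Definition bounded_operator T : Prop :=
  [/\ linear_operator T, dom T = setT & norm_bounded T].

Definition compact_operator T : Prop :=
  bounded_operator T /\
  forall x y : nat -> H,
    (forall k, T (x k, y k)) -> (forall k, hnorm (x k) <= 1) ->
    exists (phi : nat -> nat) (l : H),
      (forall k, (phi k < phi k.+1)%N) /\ hcvg (y \o phi) l.

Definition resolvent T z : graph R I :=
  op_inv (op_add T (op_scale (- z) op_id)).

Definition resolvent_set T : set R[i] :=
  [set z | bounded_operator (resolvent T z)].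

Definition compact_resolvent T : Prop :=
  exists2 z, resolvent_set T z & compact_operator (resolvent T z).

(* Commutation of [T], possibly unbounded, with a closed unbounded operator
   [A]: every resolvent [(T - z)^-1] satisfies
   [(T - z)^-1 A] included in [A (T - z)^-1].  For bounded [T] this amounts
   to [T A] being included in [A T]. *)
Definition commutes_with T A : Prop :=
  forall z, resolvent_set T z ->
    op_comp (resolvent T z) A `<=` op_comp A (resolvent T z).

(* [P] is [|T| = (T^* T)^(1/2)]. *)
Definition is_abs T P : Prop :=
  positive P /\ op_comp P P = op_comp (op_adj T) T.

Definition op_ker T : set H := [set x | T (x, 0)].

Definition orthocomp (V : set H) : set H :=
  [set x | forall v, V v -> inner v x = 0].

(* For self-adjoint [T]: the inverse of [T] on the orthogonal complement of
   its kernel, extended by [0] on the kernel. *)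
Definition inv_off_ker T : graph R I :=
  [set p | orthocomp (op_ker T) p.2 /\
           exists2 y, T (p.2, y) & op_ker T (p.1 - y)].

(* [mu 0 >= mu 1 >= ...] are the singular values of [T], that is the
   eigenvalues of [|T|] counted with multiplicity; positivity of [|T|] makes
   them nonnegative, and they are padded by zeros if [T] has finite rank. *)
Definition singular_values T (mu : nat -> R) : Prop :=
  (forall k, mu k.+1 <= mu k) /\
  exists P u, [/\ is_abs T P, orthonormal u,
    (forall k, P (u k, (mu k)%:C%C *: u k)) &
    (forall x, (forall k, inner x (u k) = 0) -> P (x, 0))].

(* The ideal [L^(1,oo)]. *)
Definition dixmier_ideal T : Prop :=
  compact_operator T /\
  exists2 mu, singular_values T mu &
    (fun N => \sum_(k < N) mu k) =O_\oo (fun N => ln N%:R).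

Definition p_summable (p : nat) D : Prop :=
  exists2 P, is_abs D P & dixmier_ideal (inv_off_ker (op_pow P p)).

Inductive star_subalgebra_gen (G : set (graph R I)) : graph R I -> Prop :=
| star_gen T : G T -> star_subalgebra_gen G T
| star_id : star_subalgebra_gen G op_id
| star_scale z T :
    star_subalgebra_gen G T -> star_subalgebra_gen G (op_scale z T)
| star_add S T : star_subalgebra_gen G S -> star_subalgebra_gen G T ->
    star_subalgebra_gen G (op_add S T)
| star_comp S T : star_subalgebra_gen G S -> star_subalgebra_gen G T ->
    star_subalgebra_gen G (op_comp S T)
| star_adj T : star_subalgebra_gen G T -> star_subalgebra_gen G (op_adj T).

Definition bounded_commutator D T : Prop :=
  dom D `<=` dom (op_commutator D T) /\ norm_bounded (op_commutator D T).

(* The C*-algebra of the triple is the norm closure of the dense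
   star-subalgebra [Af]; the axioms only involve [Af]. *)
Definition odd_spectral_triple (Af : set (graph R I)) D : Prop :=
  [/\ self_adjoint D, compact_resolvent D &
      forall T, Af T -> bounded_commutator D T].

(* The operator sending the basis vector of index [s] to [f s]: it maps [x]
   to the coordinatewise sum of the [x s *: f s] whenever this is square
   summable.  It is meant for [f] such that, for each [t], only finitely many
   [f s t] are nonzero. *)
Definition op_of_basis (f : I -> H) : graph R I :=
  [set p : H * H | forall t, p.2 t = complex_sum (fun s => p.1 s * f s t)].

End operators.

(* The index [(n, i, j)], with [n] in [{0, 1/2, 1, ...}] and
   [i, j] in [{-n, -n + 1, ..., n}], is encoded by the natural numbers
   [2n] and [n + i, n + j <= 2n]. *)
Definition suq2_index : choiceType := {N : nat & ('I_N.+1 * 'I_N.+1)%type}.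

Section suq2.
Variable R : realType.
Local Notation H := (ell2 R suq2_index).
Implicit Types (q n i j : R) (s : suq2_index).

Definition spin s : R := (tag s)%:R / 2.
Definition row_index s : R := ((tagged s).1 : nat)%:R - spin s.
Definition col_index s : R := ((tagged s).2 : nat)%:R - spin s.

Definition is_index n i j s : bool :=
  [&& spin s == n, row_index s == i & col_index s == j].

Lemma is_index_inj n i j s t : is_index n i j s -> is_index n i j t -> s = t.
Proof.
case: s t => [N [a b]] [M [c d]] /and3P[/= /eqP hn /eqP hi /eqP hj].
move=> /and3P[/= /eqP hn' /eqP hi' /eqP hj'].
have n2 : (2 : R)^-1 != 0 by rewrite invr_eq0 pnatr_eq0.
have /eqP : N%:R = M%:R :> R.
  by apply: (mulIf n2); exact: etrans hn (esym hn').
rewrite eqr_nat => /eqP eNM; subst M.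
have /eqP := etrans hi (esym hi').
rewrite /row_index /spin /= (inj_eq (addIr _)) eqr_nat => /eqP /val_inj ->.
have /eqP := etrans hj (esym hj').
by rewrite /col_index /spin /= (inj_eq (addIr _)) eqr_nat => /eqP /val_inj ->.
Qed.

Lemma basis_subproof n i j :
  (fun s => (is_index n i j s)%:R : R[i]^o) \in @ell2_pred R suq2_index.
Proof.
apply/asboolP; apply: square_summable_finite.
have [[s0 s0P]|none] := pselect (exists s, is_index n i j s).
  apply: (sub_finite_set _ (finite_set1 s0)) => s /=.
  case: (boolP (is_index n i j s)) => [/is_index_inj/(_ s0P) -> //|_].
  by rewrite eqxx.
apply: (sub_finite_set _ (finite_set0 _)) => s /=.
case: (boolP (is_index n i j s)) => [sP|_]; last by rewrite eqxx.
by case: none; exists s.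
Qed.

(* The basis vector [e^(n)_(i, j)], which is [0] when [(n, i, j)] is out of
   range. *)
Definition basis n i j : H := Ell2 (basis_subproof n i j).

Definition a_plus q n i j : R :=
  Num.sqrt (q `^ (2 * (n + i) + 2 * (n + j) + 2)
    * ((1 - q `^ (2 * n - 2 * j + 2)) * (1 - q `^ (2 * n - 2 * i + 2)))
    / ((1 - q `^ (4 * n + 2)) * (1 - q `^ (4 * n + 4)))).

Definition a_minus q n i j : R :=
  Num.sqrt ((1 - q `^ (2 * n + 2 * j)) * (1 - q `^ (2 * n + 2 * i))
    / ((1 - q `^ (4 * n)) * (1 - q `^ (4 * n + 2)))).

Definition b_plus q n i j : R :=
  - Num.sqrt (q `^ (2 * (n + j))
    * ((1 - q `^ (2 * n - 2 * j + 2)) * (1 - q `^ (2 * n + 2 * i + 2)))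
    / ((1 - q `^ (4 * n + 2)) * (1 - q `^ (4 * n + 4)))).

Definition b_minus q n i j : R :=
  Num.sqrt (q `^ (2 * (n + i))
    * ((1 - q `^ (2 * n + 2 * j)) * (1 - q `^ (2 * n - 2 * i)))
    / ((1 - q `^ (4 * n)) * (1 - q `^ (4 * n + 2)))).

Definition op_of_action (f : R -> R -> R -> H) : graph R suq2_index :=
  op_of_basis (fun s => f (spin s) (row_index s) (col_index s)).

Definition alpha q := op_of_action (fun n i j =>
  (a_plus q n i j)%:C%C *: basis (n + 2^-1) (i - 2^-1) (j - 2^-1)
  + (a_minus q n i j)%:C%C *: basis (n - 2^-1) (i - 2^-1) (j - 2^-1)).

Definition beta q := op_of_action (fun n i j =>
  (b_plus q n i j)%:C%C *: basis (n + 2^-1) (i + 2^-1) (j - 2^-1)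
  + (b_minus q n i j)%:C%C *: basis (n - 2^-1) (i + 2^-1) (j - 2^-1)).

(* The algebra [A_f], identified with its image under the faithful
   representation on [H]. *)
Definition suq2_polynomials q : set (graph R suq2_index) :=
  star_subalgebra_gen [set alpha q; beta q].

(* [op_of_basis] gives the closed operators [A_0] and [A_1]: a diagonal
   operator and a weighted shift on their natural domains.  At [j = n] the
   vector [basis n i (j + 1)] is [0]. *)
Definition A0 q := op_of_action (fun n i j => (q `^ j)%:C%C *: basis n i j).

Definition A1 q := op_of_action (fun n i j =>
  (Num.sqrt (q `^ (- 2 * n) + q `^ (2 * n + 2)
             - q `^ (- 2 * j) - q `^ (2 * j + 2)))%:C%C *: basis n i (j + 1)).

Definition equivariant q (D : graph R suq2_index) : Prop :=
  [/\ commutes_with D (A0 q), commutes_with D (A1 q) &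
      commutes_with D (op_adj (A1 q))].

End suq2.

(* Main.v *)
Require Import Defs.
From mathcomp Require Import all_boot all_order all_algebra.
From mathcomp Require Import all_classical all_reals all_analysis.
From mathcomp Require Import complex ring lra.

(** The operator [D] multiplies [e^(n)_(i, j)] by [2n + 1].

    Equivariance: the operators [A_0], [A_1] and [A_1^*] preserve [n], hence
    commute with every function of [n], in particular with the resolvents of
    [D] ([mat_op_commutes], [level_equivariant]).

    Bounded commutators: [alpha] and [beta] are sums of two weighted translations
    of the index [(n, i, j)], which change [n] by [1/2] or [- 1/2]. The
    commutator of [D] with such a translation only multiplies its weights by
    [1] or [- 1], and the weights are at most [1] in absolute value. The
    operators [T] for which [T] and [T^*] preserve the domain of [D] and have a
    bounded commutator with it form a star-algebra by the Leibniz rule, so it is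
    enough to treat the generators ([mat_op_regular], [regular_star]).

    Compactness: the entries of the diagonal operators [D^-1] and [D^-3] tend to
    [0], because only finitely many basis vectors have a given [n]
    ([finite_layers], [diag_compact]).

    Summability: [D] is positive and invertible, so that [|D|^-3] is diagonal with
    entries [(2n + 1)^-3]. There are [1^2 + 2^2 + ... + (2n + 1)^2] basis vectors
    up to the layer of [n], and this is at most [(2n + 1)^3]; hence the [k]-th
    singular value is at most [1 / k], and the partial sums are bounded by those
    of the harmonic series ([rank_cube], [harmonic_le_ln], [level_dixmier]). *)

Set Implicit Arguments.
Unset Strict Implicit.
Unset Printing Implicit Defensive.
Import Order.TTheory GRing.Theory Num.Theory numFieldNormedType.Exports.
Import ComplexField.Normc ComplexField.
Local Open Scope classical_set_scope.
Local Open Scope ring_scope.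

(** * Unordered sums of real families *)

Section sums.
Variables (R : realType) (I : choiceType).
Implicit Types (f g p n : I -> R) (c : R).

Definition tsum f : \bar R := (\esum_(s in [set: I]) (f s)%:E)%E.

Lemma tsum_ge0 f : (forall s, 0 <= f s) -> (0 <= tsum f)%E.
Proof. by move=> f0; apply: esum_ge0 => s _; rewrite lee_fin. Qed.

Lemma tsum_le f g : (forall s, f s <= g s) -> (tsum f <= tsum g)%E.
Proof. by move=> fg; apply: le_esum => s _; rewrite lee_fin. Qed.

Lemma tsumD f g : (forall s, 0 <= f s) -> (forall s, 0 <= g s) ->
  tsum (fun s => f s + g s) = (tsum f + tsum g)%E.
Proof.
move=> f0 g0; rewrite /tsum -esumD; first by apply: eq_esum => s _.
  by move=> s _; rewrite lee_fin.
by move=> s _; rewrite lee_fin.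
Qed.

Lemma tsumZ c f : 0 <= c -> (forall s, 0 <= f s) ->
  tsum (fun s => c * f s) = (c%:E * tsum f)%E.
Proof.
have le k h : 0 <= k -> (forall s, 0 <= h s) ->
    (tsum (fun s => k * h s)%R <= k%:E * tsum h)%E.
  move=> k0 h0; apply: ge_ereal_sup => _ [X [finX XI] <-].
  have -> : \sum_(s \in X) (k * h s)%:E = (k%:E * \sum_(s \in X) (h s)%:E)%E.
    by rewrite ge0_mule_fsumr // => s; rewrite lee_fin.
  by apply: lee_wpmul2l; rewrite ?lee_fin // esum_ge //; exists X.
move=> c0 f0; apply/eqP; rewrite eq_le le //=.
have [->|cn0] := eqVneq c 0.
  by rewrite mul0e tsum_ge0 // => s; rewrite mul0r.
have cp : 0 < c by rewrite lt_def cn0.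
rewrite -lee_pdivlMl // muleC.
have {1}-> : f = (fun s => c^-1 * (c * f s)).
  by apply/funext => s; rewrite mulrA mulVf // mul1r.
by rewrite muleC le ?invr_ge0 // => s; rewrite mulr_ge0.
Qed.

Lemma tsum_ler f s : (forall s, 0 <= f s) -> ((f s)%:E <= tsum f)%E.
Proof.
move=> f0; apply: esum_ge; exists [set s]; first by split.
by rewrite fsbig_set1.
Qed.

Lemma tsum_single f s0 : 0 <= f s0 -> (forall s, s != s0 -> f s = 0) ->
  tsum f = (f s0)%:E.
Proof.
move=> f0 fs.
have <- : (\esum_(s in [set s0]) (f s)%:E)%E = (f s0)%:E.
  by rewrite esum_set1 // lee_fin.
rewrite [RHS]esum_mkcond; apply: eq_esum => s _.
by case: ifPn => // /negP; rewrite inE /= => /eqP /fs ->.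
Qed.

Lemma tsum0 f : (forall s, f s = 0) -> tsum f = 0%E.
Proof.
move=> f0; rewrite /tsum (eq_esum (b := fun=> 0%E)) ?esum1 // => s _.
by rewrite f0.
Qed.

Definition rsummable f := (tsum (fun s => `|f s|%R) < +oo)%E.

Lemma real_sumB p n : (forall s, 0 <= p s) -> (forall s, 0 <= n s) ->
  (tsum p < +oo)%E -> (tsum n < +oo)%E ->
  real_sum (fun s => p s - n s) = fine (tsum p) - fine (tsum n).
Proof.
move=> p0 n0 fp fn; rewrite /real_sum.
have := @esumB R I [set: I] (EFin \o p) (EFin \o n).
rewrite /summable => -> //.
- rewrite fineB // ge0_fin_numE ?tsum_ge0 //.
- apply: le_lt_trans fp; apply: le_esum => s _ /=; by rewrite ger0_norm.
- apply: le_lt_trans fn; apply: le_esum => s _ /=; by rewrite ger0_norm.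
- by move=> s _; rewrite lee_fin.
- by move=> s _; rewrite lee_fin.
Qed.

(** Positive and negative parts reduce the linearity of signed sums to the
    additivity of sums of nonnegative families. *)
Lemma rsummable_split f : rsummable f -> exists p n,
  [/\ forall s, 0 <= p s, forall s, 0 <= n s, (tsum p < +oo)%E,
      (tsum n < +oo)%E & f = (fun s => p s - n s)].
Proof.
move=> fs; exists (fun s => (`|f s| + f s) / 2), (fun s => (`|f s| - f s) / 2).
have h s : - `|f s| <= f s <= `|f s| by rewrite -ler_norml.
split=> [s|s|||].
- by have := h s; lra.
- by have := h s; lra.
- by apply: le_lt_trans fs; apply: tsum_le => s; have := h s; lra.
- by apply: le_lt_trans fs; apply: tsum_le => s; have := h s; lra.
- by apply/funext => s; field.
Qed.

Lemma real_sumD f g : rsummable f -> rsummable g ->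
  real_sum (fun s => f s + g s) = real_sum f + real_sum g.
Proof.
move=> /rsummable_split [p [n [p0 n0 fp fn ->]]].
move=> /rsummable_split [p' [n' [p'0 n'0 fp' fn' ->]]].
transitivity (real_sum (fun s => (p s + p' s) - (n s + n' s))).
  by congr real_sum; apply/funext => s; ring.
have fin (h : I -> R) : (forall s, 0 <= h s) -> (tsum h < +oo)%E ->
  tsum h \is a fin_num by move=> *; rewrite ge0_fin_numE ?tsum_ge0.
rewrite !real_sumB // ?tsumD //; last 4 first.
- by move=> s; rewrite addr_ge0.
- by move=> s; rewrite addr_ge0.
- exact: lte_add_pinfty.
- exact: lte_add_pinfty.
by rewrite !fineD ?fin //; ring.
Qed.

Lemma real_sumZ c f : rsummable f -> real_sum (fun s => c * f s) = c * real_sum f.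
Proof.
move=> /rsummable_split [p [n [p0 n0 fp fn ->]]].
have finZ k (h : I -> R) : 0 <= k -> (forall s, 0 <= h s) -> (tsum h < +oo)%E ->
  (tsum (fun s => k * h s)%R < +oo)%E.
  by move=> k0 h0 hf; rewrite tsumZ // lte_mul_pinfty // lee_fin.
have fin (h : I -> R) : (forall s, 0 <= h s) -> (tsum h < +oo)%E ->
  tsum h \is a fin_num by move=> *; rewrite ge0_fin_numE ?tsum_ge0.
have [c0|c0] := leP 0 c.
  transitivity (real_sum (fun s => c * p s - c * n s)).
    by congr real_sum; apply/funext => s; ring.
  by rewrite !real_sumB ?finZ // ?tsumZ ?fineM ?fin //= ?mulrBr // => s;
    rewrite mulr_ge0.
have {}c0 : 0 <= - c by lra.
transitivity (real_sum (fun s => (- c) * n s - (- c) * p s)).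
  by congr real_sum; apply/funext => s; ring.
have m0 (h : I -> R) : (forall s, 0 <= h s) -> forall s, 0 <= - c * h s.
  by move=> h0 s; rewrite mulr_ge0.
rewrite !real_sumB ?finZ //; try exact: m0.
by rewrite !tsumZ // !fineM ?fin //=; ring.
Qed.

Lemma real_sum_ge0 f : (forall s, 0 <= f s) -> real_sum f = fine (tsum f).
Proof.
move=> f0; rewrite /real_sum.
have -> : (\esum_(s in [set: I]) ((EFin \o f)^\- s) = 0)%E.
  rewrite (eq_esum (b := fun=> 0%E)) ?esum1 // => s _; rewrite funenegE; apply/max_idPr.
  by rewrite /= lee_fin oppr_le0.
rewrite sube0; congr fine; apply: eq_esum => s _.
by rewrite funeposE; apply/max_idPl; rewrite lee_fin.
Qed.

End sums.

(** * Unordered sums of complex families *)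

Section complex_sums.
Variables (R : realType) (I : choiceType).
Implicit Types (f g : I -> R[i]) (z : R[i]).

Lemma normc_real (r : R) : normc r%:C%C = `|r|.
Proof. by rewrite /= expr0n /= addr0 sqrtr_sqr. Qed.

Lemma normcJ z : normc z^*%C = normc z.
Proof. by case: z => a b /=; rewrite sqrrN. Qed.

Lemma conjcM z z' : (z * z')^*%C = z^*%C * z'^*%C.
Proof. exact: rmorphM. Qed.

Lemma real_complexM (a b : R) : (a * b)%:C%C = a%:C%C * b%:C%C :> R[i].
Proof. exact: rmorphM. Qed.

Lemma normc_Re z : `|complex.Re z| <= normc z.
Proof.
by case: z => a b /=; rewrite -sqrtr_sqr ler_wsqrtr // lerDl sqr_ge0.
Qed.

Lemma normc_Im z : `|complex.Im z| <= normc z.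
Proof.
by case: z => a b /=; rewrite -sqrtr_sqr ler_wsqrtr // lerDr sqr_ge0.
Qed.

Lemma normc_sq z : normc z ^+ 2 = complex.Re z ^+ 2 + complex.Im z ^+ 2.
Proof. by case: z => a b /=; rewrite sqr_sqrtr // addr_ge0 ?sqr_ge0. Qed.

Lemma mulcJ z : z * z^*%C = (normc z ^+ 2)%:C%C.
Proof.
by rewrite normc_sq; case: z => a b; apply/eqP; rewrite eq_complex /=;
  apply/andP; split; apply/eqP; ring.
Qed.

Definition abs_summable f := (tsum (fun s => normc (f s)) < +oo)%E.

Lemma abs_summable_Re f : abs_summable f -> rsummable (fun s => complex.Re (f s)).
Proof. by apply: le_lt_trans; apply: tsum_le => s; exact: normc_Re. Qed.

Lemma abs_summable_Im f : abs_summable f -> rsummable (fun s => complex.Im (f s)).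
Proof. by apply: le_lt_trans; apply: tsum_le => s; exact: normc_Im. Qed.

Lemma abs_summable_single f s0 : (forall s, s != s0 -> f s = 0) -> abs_summable f.
Proof.
move=> fs; rewrite /abs_summable (@tsum_single _ _ _ s0) ?ltry //.
  exact: normc_ge0.
by move=> s /fs ->; rewrite normc0.
Qed.

Lemma eq_complex_sum f g : f =1 g -> complex_sum f = complex_sum g.
Proof. by move=> /funext ->. Qed.

Lemma complex_sumD f g : abs_summable f -> abs_summable g ->
  complex_sum (fun s => f s + g s) = complex_sum f + complex_sum g.
Proof.
move=> fs gs; apply/eqP; rewrite eq_complex /=; apply/andP; split; apply/eqP.
  rewrite -real_sumD; try exact: abs_summable_Re.
  by congr real_sum; apply/funext => s; case: (f s); case: (g s).
rewrite -real_sumD; try exact: abs_summable_Im.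
by congr real_sum; apply/funext => s; case: (f s); case: (g s).
Qed.

Lemma complex_sumZ z f : abs_summable f ->
  complex_sum (fun s => z * f s) = z * complex_sum f.
Proof.
have rZ c (h : I -> R) : rsummable h -> rsummable (fun s => c * h s).
  move=> hs; rewrite /rsummable.
  rewrite (_ : (fun s => _) = (fun s => `|c| * `|h s|)); last first.
    by apply/funext => s; rewrite normrM.
  by rewrite tsumZ // lte_mul_pinfty // ?lee_fin.
move=> fs; have [fr fi] := (abs_summable_Re fs, abs_summable_Im fs).
case: z => a b; apply/eqP; rewrite eq_complex /=; apply/andP; split; apply/eqP.
  rewrite -!real_sumZ // -mulN1r -real_sumZ; last exact: rZ.
  rewrite -real_sumD; [|exact: rZ|exact/rZ/rZ].
  by congr real_sum; apply/funext => s; case: (f s) => u v /=; ring.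
rewrite -!real_sumZ // -real_sumD; [|exact: rZ|exact: rZ].
by congr real_sum; apply/funext => s; case: (f s) => u v /=; ring.
Qed.

Lemma complex_sum_conj f : abs_summable f ->
  complex_sum (fun s => (f s)^*%C) = (complex_sum f)^*%C.
Proof.
move=> fs; apply/eqP; rewrite eq_complex /=; apply/andP; split; apply/eqP.
  by congr real_sum; apply/funext => s; case: (f s).
rewrite -mulN1r -real_sumZ; last exact: abs_summable_Im.
by congr real_sum; apply/funext => s; case: (f s) => u v /=; rewrite mulN1r.
Qed.

Lemma real_sum_single (f : I -> R) s0 : (forall s, s != s0 -> f s = 0) ->
  real_sum f = f s0.
Proof.
move=> fs; have [f0|f0] := leP 0 (f s0).
  rewrite real_sum_ge0 ?(@tsum_single _ _ _ s0) // => s.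
  by have [->//|/fs ->] := eqVneq s s0.
rewrite -[f]opprK (_ : - - f = fun s => -1 * (- f s)); last first.
  by apply/funext => s; rewrite mulN1r.
have fN s : 0 <= - f s.
  by have [->|/fs ->] := eqVneq s s0; rewrite ?oppr0 // oppr_ge0 ltW.
have fNs s : s != s0 -> - f s = 0 by move=> /fs ->; rewrite oppr0.
have fNt : tsum (fun s => - f s) = (- f s0)%:E by rewrite (tsum_single _ fNs).
rewrite real_sumZ; first by rewrite real_sum_ge0 // fNt /= mulN1r.
rewrite /rsummable; under eq_fun do rewrite ger0_norm //.
by rewrite fNt ltry.
Qed.

Lemma complex_sum_single f s0 : (forall s, s != s0 -> f s = 0) ->
  complex_sum f = f s0.
Proof.
move=> fs; rewrite /complex_sum !(@real_sum_single _ s0); first by case: (f s0).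
  by move=> s /fs ->.
by move=> s /fs ->.
Qed.

Lemma complex_sum0 f : (forall s, f s = 0) -> complex_sum f = 0.
Proof.
move=> f0; rewrite /complex_sum !real_sum_ge0 => [|s|s]; rewrite ?f0 //.
by rewrite !tsum0 // => s; rewrite f0.
Qed.

End complex_sums.

(** * Square summable families as a Hilbert space *)

Section hilbert.
Variables (R : realType) (I : choiceType).
Local Notation H := (ell2 R I).
Implicit Types (x y : H) (z : R[i]).

Lemma ell2DE x y s : (x + y) s = x s + y s. Proof. by []. Qed.
Lemma ell2NE x s : (- x) s = - x s. Proof. by []. Qed.
Lemma ell2ZE z x s : (z *: x) s = z * x s. Proof. by []. Qed.
Lemma ell20E s : (0 : H) s = 0. Proof. by []. Qed.

Lemma ell2_ext x y : (forall s, x s = y s) -> x = y.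
Proof. by move=> xy; apply: val_inj; apply/funext. Qed.

Lemma square_summable_coord x : square_summable x.
Proof. by case: x => f fP; apply/asboolP. Qed.

Lemma ell2_exists (f : I -> R[i]) : square_summable (f : I -> R[i]^o) ->
  exists x : H, forall s, x s = f s.
Proof. by move=> /asboolP fP; exists (Ell2 fP). Qed.

Definition sqn (f : I -> R[i]) : \bar R := tsum (fun s => normc (f s) ^+ 2).

Lemma sqn_ge0 f : (0 <= sqn f)%E.
Proof. by apply: tsum_ge0 => s; exact: sqr_ge0. Qed.

Lemma hnorm_ge0 x : 0 <= hnorm x. Proof. exact: sqrtr_ge0. Qed.

Lemma sqnE x : sqn x = (hnorm x ^+ 2)%:E.
Proof.
have fx : sqn x \is a fin_num.
  by rewrite ge0_fin_numE ?sqn_ge0 //; exact: square_summable_coord.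
rewrite /hnorm sqr_sqrtr.
  rewrite /= (_ : (fun s => _) = (fun s => normc (x s) ^+ 2)); last first.
    by apply/funext => s; rewrite mulcJ.
  by rewrite real_sum_ge0 ?fineK // => s; rewrite sqr_ge0.
rewrite /= real_sum_ge0; last by move=> s; rewrite mulcJ sqr_ge0.
by rewrite fine_ge0 // tsum_ge0 // => s; rewrite mulcJ sqr_ge0.
Qed.

(** Norms are compared through the extended real sum [sqn], which makes sense
    before square summability is known. *)
Lemma hnorm_le x (C : R) : 0 <= C -> (sqn x <= (C ^+ 2)%:E)%E -> hnorm x <= C.
Proof.
by move=> C0; rewrite sqnE lee_fin ler_pXn2r // nnegrE hnorm_ge0.
Qed.

Lemma square_summable_dom (f g : I -> R[i]^o) (C : R) :
  0 <= C -> (forall s, normc (f s) <= C * normc (g s)) ->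
  square_summable g -> square_summable f.
Proof.
move=> C0 fg gs; apply: (@le_lt_trans _ _ ((C ^+ 2)%:E * sqn g)%E).
  rewrite -tsumZ ?sqr_ge0 // => [|s]; last exact: sqr_ge0.
  apply: tsum_le => s; rewrite -exprMn.
  by rewrite ler_pXn2r // nnegrE ?mulr_ge0 ?normc_ge0.
by rewrite lte_mul_pinfty // ?lee_fin ?sqr_ge0.
Qed.

Lemma hnorm_dom x y (C : R) :
  0 <= C -> (forall s, normc (x s) <= C * normc (y s)) -> hnorm x <= C * hnorm y.
Proof.
move=> C0 xy; apply: hnorm_le; first by rewrite mulr_ge0 ?hnorm_ge0.
rewrite exprMn EFinM -sqnE -tsumZ ?sqr_ge0 // => [|s]; last exact: sqr_ge0.
apply: tsum_le => s; rewrite -exprMn.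
by rewrite ler_pXn2r // nnegrE ?mulr_ge0 ?normc_ge0.
Qed.

Lemma ell2_hnormZ z x : hnorm (z *: x) <= normc z * hnorm x.
Proof.
by apply: hnorm_dom => [|s]; [exact: normc_ge0 | rewrite ell2ZE normcM].
Qed.

(** The parallelogram law without its second term. *)
Lemma normcD_sq (u v : R[i]) :
  normc (u + v) ^+ 2 <= 2 * normc u ^+ 2 + 2 * normc v ^+ 2.
Proof.
apply: (@le_trans _ _ ((normc u + normc v) ^+ 2)).
  by rewrite ler_pXn2r ?nnegrE ?addr_ge0 ?normc_ge0 //; exact: le_normcD.
by rewrite -subr_ge0; have := sqr_ge0 (normc u - normc v); congr (_ <= _); ring.
Qed.

(** A cheap substitute for the triangle inequality: all the estimates below are
    up to constants, so the factor 2 is harmless and Cauchy-Schwarz is avoided. *)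
Lemma ell2_hnormD x y : hnorm (x + y) <= 2 * (hnorm x + hnorm y).
Proof.
apply: hnorm_le; first by rewrite mulr_ge0 ?addr_ge0 ?hnorm_ge0.
apply: (@le_trans _ _ (2%:E * sqn x + 2%:E * sqn y)%E).
  rewrite -!tsumZ // => [|s|s]; try exact: sqr_ge0.
  rewrite -tsumD => [|s|s]; try by rewrite mulr_ge0 // sqr_ge0.
  by apply: tsum_le => s; exact: normcD_sq.
rewrite !sqnE -!EFinM -EFinD lee_fin.
by have := hnorm_ge0 x; have := hnorm_ge0 y; nra.
Qed.

(** From [2ab <= a^2 + b^2], which is enough to make the inner product linear. *)
Lemma abs_summable_inner x y : abs_summable (fun s => x s * (y s)^*%C).
Proof.
apply: (@le_lt_trans _ _ (sqn x + sqn y)%E); last first.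
  by apply: lte_add_pinfty; exact: square_summable_coord.
rewrite -tsumD => [|s|s]; try exact: sqr_ge0.
apply: tsum_le => s; rewrite normcM normcJ.
by have := normc_ge0 (x s); have := normc_ge0 (y s); nra.
Qed.

Lemma innerC x y : inner y x = (inner x y)^*%C.
Proof.
rewrite -complex_sum_conj; last exact: abs_summable_inner.
by apply: eq_complex_sum => s; rewrite rmorphM /= conjcK mulrC.
Qed.

Lemma innerDl x x' y : inner (x + x') y = inner x y + inner x' y.
Proof.
rewrite -complex_sumD; try exact: abs_summable_inner.
by apply: eq_complex_sum => s; rewrite ell2DE mulrDl.
Qed.

Lemma innerZl z x y : inner (z *: x) y = z * inner x y.
Proof.
rewrite -complex_sumZ; last exact: abs_summable_inner.
by apply: eq_complex_sum => s; rewrite ell2ZE mulrA.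
Qed.

Lemma innerDr x y y' : inner x (y + y') = inner x y + inner x y'.
Proof. by rewrite innerC innerDl rmorphD (innerC y x) (innerC y' x). Qed.

Lemma innerZr z x y : inner x (z *: y) = z^*%C * inner x y.
Proof. by rewrite innerC innerZl rmorphM (innerC y x). Qed.

Lemma delta_subproof t : (fun s => (s == t)%:R : R[i]^o) \in @ell2_pred R I.
Proof.
apply/asboolP; apply: square_summable_finite.
apply: (sub_finite_set _ (finite_set1 t)) => s /=.
by have [->//|] := eqVneq s t; rewrite eqxx.
Qed.

Definition delta t : H := Ell2 (delta_subproof t).

Lemma inner_delta_l t y : inner (delta t) y = (y t)^*%C.
Proof.
rewrite /inner (@complex_sum_single _ _ _ t) /= ?eqxx ?mul1r // => s /negbTE ->.
by rewrite mul0r.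
Qed.

Lemma inner_delta_r t x : inner x (delta t) = x t.
Proof. by rewrite innerC inner_delta_l conjcK. Qed.

Lemma inner_ext x y : (forall v, inner v x = inner v y) -> x = y.
Proof.
move=> xy; apply: ell2_ext => t; apply: (can_inj (@conjcK R)).
by rewrite -!inner_delta_l xy.
Qed.

Lemma hnorm_coord x s : normc (x s) <= hnorm x.
Proof.
rewrite -(@ler_pXn2r _ 2) ?nnegrE ?normc_ge0 ?hnorm_ge0 // -lee_fin -sqnE.
exact: (@tsum_ler _ _ (fun s => normc (x s) ^+ 2) s (fun s => sqr_ge0 _)).
Qed.

End hilbert.

(** * Approximation by finite sums *)

Section finite_sums.
Variables (R : realType) (I : choiceType).
Implicit Types (f : I -> R) (X : seq I).

(** Puts finite and infinite sums on the same footing, so that [tsumD] and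
    [tsum_le] apply to both. *)
Lemma tsum_seq f X : uniq X -> (forall s, 0 <= f s) ->
  tsum (fun s => if s \in X then f s else 0) = (\sum_(s <- X) f s)%:E.
Proof.
move=> uX f0; rewrite -sumEFin fsbig_seq //.
rewrite -esum_fset //; last by move=> s _; rewrite lee_fin.
rewrite [RHS]esum_mkcond; apply: eq_esum => s _.
by rewrite mem_setE; case: ifP.
Qed.

Lemma fsbig_seq_exists (X : set I) f : finite_set X ->
  exists2 Y : seq I, uniq Y &
    (\sum_(s \in X) (f s)%:E)%E = (\sum_(s <- Y) f s)%:E.
Proof.
move=> fX; exists (finmap.enum_fset (fset_set X)); first exact: finmap.fset_uniq.
by rewrite fsbig_finite //= sumEFin.
Qed.

Lemma tsum_le_seq f (M : R) :
  (forall X, uniq X -> \sum_(s <- X) f s <= M) -> (tsum f <= M%:E)%E.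
Proof.
move=> fM; apply: ge_ereal_sup => _ [X [finX XI] <-].
by have [Y uY ->] := fsbig_seq_exists f finX; rewrite lee_fin fM.
Qed.

Lemma tsum_approx f (e : R) : (forall s, 0 <= f s) -> (tsum f < +oo)%E -> 0 < e ->
  exists2 X, uniq X & (tsum f - e%:E < (\sum_(s <- X) f s)%:E)%E.
Proof.
move=> f0 ff e0.
have fin : tsum f \is a fin_num by rewrite ge0_fin_numE ?tsum_ge0.
have [_ [X [finX _] <-] lt] := ub_ereal_sup_adherent e0 fin.
have [Y uY eY] := fsbig_seq_exists f finX.
by exists Y; rewrite // -eY.
Qed.

Lemma seq_sum_le f X (M : R) : (forall s, 0 <= f s) -> uniq X ->
  (tsum f <= M%:E)%E -> \sum_(s <- X) f s <= M.
Proof.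
move=> f0 uX fM; rewrite -lee_fin -tsum_seq //; apply: le_trans fM.
by apply: tsum_le => s; case: ifP.
Qed.

End finite_sums.

(** * Weak compactness of the unit ball *)

Section compactness.
Variables (R : realType) (I : choiceType).
Local Notation H := (ell2 R I).

Lemma normc_sqB (u v : R[i]) : normc (u - v) ^+ 2 =
  (complex.Re u - complex.Re v) ^+ 2 + (complex.Im u - complex.Im v) ^+ 2.
Proof. by rewrite normc_sq; case: u => a b; case: v. Qed.

(** Banach-Alaoglu for a ball of the Hilbert space, in sequential form. The real
    and imaginary parts of the coordinates lie between -1 and 1, so by Tychonoff the
    sequence clusters at some family [l] for pointwise convergence. Finite sums
    of squares are continuous for this topology: hence the conclusion, and the
    square summability of [l]. The bound 2 in place of 1 comes from
    [normcD_sq]. *)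
Lemma ball_cluster (x : nat -> H) : (forall k, hnorm (x k) <= 1) ->
  exists2 l : H, hnorm l <= 2 & forall (X : seq I) (e : R) m, 0 < e ->
    exists2 n, (m <= n)%N & \sum_(s <- X) normc (x n s - l s) ^+ 2 < e.
Proof.
move=> x1.
(* The pair [(true, s)] indexes the real part of the coordinate [s], and
   [(false, s)] its imaginary part. *)
pose T := fun _ : (bool * I)%type => R : topologicalType.
pose c (k : nat) : prod_topology T := fun i =>
  if i.1 then complex.Re (x k i.2) else complex.Im (x k i.2).
have cA k i : `[-1, 1]%classic (c k i).
  have h s : normc (x k s) <= 1 by exact: le_trans (hnorm_coord _ _) (x1 k).
  rewrite /= in_itv /= -ler_norml /c; case: i => [[] s] /=.
    exact: le_trans (normc_Re _) (h s).
  exact: le_trans (normc_Im _) (h s).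
have [f [_ fcl]] : exists f : prod_topology T,
    ([set f | forall i, `[-1, 1]%classic (f i)] `&` cluster (c @ \oo)) f.
  have cpt : @compact (prod_topology T) [set f | forall i, `[-1, 1]%classic (f i)].
    by apply: (@tychonoff _ T (fun=> `[-1, 1]%classic)) => i; exact: segment_compact.
  have FA : (c @ \oo) [set f | forall i, `[-1, 1]%classic (f i)].
    by exists 0%N => // n _ i; exact: cA.
  have [f fP] := cpt (c @ \oo) _ FA.
  by exists f.
pose l s : R[i]^o := (f (true, s) +i* f (false, s))%C.
have clos (X : seq I) (e : R) m : 0 < e ->
    exists2 n, (m <= n)%N & \sum_(s <- X) normc (x n s - l s) ^+ 2 < e.
  move=> e0.
  pose G (Y : seq I) (g : prod_topology T) : R := \sum_(s <- Y)
    ((g (true, s) - f (true, s)) ^+ 2 + (g (false, s) - f (false, s)) ^+ 2).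
  (* Evaluation at a coordinate is continuous. *)
  have near1 i (d : R) : 0 < d ->
      nbhs f [set g : prod_topology T | `|(g i : R) - (f i : R)| < d].
    move=> d0; apply: (@proj_continuous _ T i f [set u : R | `|u - f i| < d]).
    by apply/nbhs_ballP; exists d => //= u; rewrite /ball /= distrC.
  have nbG Y d : 0 < d -> nbhs f [set g | G Y g < d].
    elim: Y d => [|s Y IH] d d0.
      by apply: filterS filterT => g _ /=; rewrite /G big_nil.
    (* If [|u| < 1] and [|u| < d / 4], then [u ^+ 2 < d / 4]. *)
    have m0 : 0 < Num.min 1 (d / 4) :> R by rewrite lt_min ltr01 divr_gt0.
    have d2 : 0 < d / 2 by rewrite divr_gt0.
    apply: filterS (filterI (near1 (true, s) _ m0)
      (filterI (near1 (false, s) _ m0) (IH _ d2))) => g /=.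
    rewrite !lt_min => -[/andP[a1 a2]] [/andP[b1 b2]] Gd.
    rewrite /G big_cons -/(G Y g).
    have sq (u : R) : `|u| < 1 -> `|u| < d / 4 -> u ^+ 2 < d / 4.
      move=> u1 ud; rewrite -(real_normK (num_real u)).
      by have := normr_ge0 u; rewrite expr2; nra.
    by have := sq _ a1 a2; have := sq _ b1 b2; lra.
  have [_ [[n /= mn <-] Gn]] : ([set c n | n in [set n | (m <= n)%N]]
      `&` [set g | G X g < e]) !=set0.
    by apply: fcl; [exists m => // n /= mn; exists n | exact: nbG].
  exists n => //; apply: le_lt_trans Gn; rewrite le_eqVlt; apply/orP; left.
  by apply/eqP; apply: eq_bigr => s _; rewrite normc_sqB.
have lsum : (tsum (fun s => normc (l s) ^+ 2)%R <= 4%:E)%E.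
  apply: tsum_le_seq => X uX; have [n _ Xn] := clos X 1 0%N ltr01.
  apply: (@le_trans _ _ (\sum_(s <- X)
      (2 * normc (x n s) ^+ 2 + 2 * normc (x n s - l s) ^+ 2))).
    apply: ler_sum => s _.
    have -> : l s = x n s + - (x n s - l s) by rewrite opprB addrC subrK.
    by apply: le_trans (normcD_sq _ _) _; rewrite normcN opprB addrCA subrr addr0.
  rewrite big_split /= -!mulr_sumr.
  have : \sum_(s <- X) normc (x n s) ^+ 2 <= 1.
    apply: seq_sum_le => // [s|]; first exact: sqr_ge0.
    rewrite -/(sqn (x n)) sqnE lee_fin; have := x1 n; have := hnorm_ge0 (x n); nra.
  by lra.
have [l' l'E] : exists l' : H, forall s, l' s = l s.
  by apply: ell2_exists; apply: le_lt_trans lsum _; rewrite ltry.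
exists l'; last first.
  move=> X e m e0; have [n mn Xn] := clos X e m e0; exists n => //.
  by under eq_bigr do rewrite l'E.
apply: hnorm_le => //.
apply: (@le_trans _ _ 4%:E); last by rewrite lee_fin expr2; lra.
by apply: le_trans lsum; apply: tsum_le => s; rewrite l'E.
Qed.

End compactness.

(** * Diagonal operators *)

Section diagonal.
Variables (R : realType) (I : choiceType).
Local Notation H := (ell2 R I).
Implicit Types (d e : I -> R) (x y : H).

Definition diag d : graph R I :=
  [set p : H * H | forall t, p.2 t = (d t)%:C%C * p.1 t].

Lemma diagP d x y : diag d (x, y) <-> forall t, y t = (d t)%:C%C * x t.
Proof. by []. Qed.

Lemma eq_diag d e : d =1 e -> diag d = diag e.
Proof. by move=> /funext ->. Qed.

Lemma diag_exists d x (C : R) : (forall t, `|d t| <= C) -> exists y, diag d (x, y).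
Proof.
move=> dC; have [y yE] : exists y : H, forall t, y t = (d t)%:C%C * x t.
  apply: ell2_exists.
  apply: (square_summable_dom (C := Num.max 0 C)) (square_summable_coord x).
    by rewrite le_max lexx.
  move=> t; rewrite normcM normc_real ler_wpM2r ?normc_ge0 //.
  by rewrite le_max dC orbT.
by exists y.
Qed.

Lemma diag_linear d : linear_operator (diag d).
Proof.
split=> [|z x y x' y' /diagP xy /diagP x'y'|x y y' /diagP xy /diagP xy'].
- by apply/diagP => t; rewrite !ell20E mulr0.
- by apply/diagP => t; rewrite !ell2DE !ell2ZE xy x'y' mulrDr mulrCA.
- by apply: ell2_ext => t; rewrite xy xy'.
Qed.

Lemma diag_bounded d (C : R) : (forall t, `|d t| <= C) ->
  bounded_operator (diag d).
Proof.
move=> dC; split; first exact: diag_linear.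
  by apply/seteqP; split=> // x _; exact: diag_exists dC.
exists (Num.max 0 C) => x y /diagP xy.
apply: hnorm_dom; first by rewrite le_max lexx.
move=> t; rewrite xy normcM normc_real ler_wpM2r ?normc_ge0 //.
by rewrite le_max dC orbT.
Qed.

Lemma diag_delta d t : diag d (delta R t, (d t)%:C%C *: delta R t).
Proof.
apply/diagP => s; rewrite ell2ZE /=.
by have [->//|_] := eqVneq s t; rewrite !mulr0.
Qed.

(** The tail of a convergent sum of squares is small; this gives density of every
    domain that contains the finitely supported vectors. *)
Lemma truncation x (e : R) : 0 < e -> exists X y,
  (forall s, y s = if s \in (X : seq I) then x s else 0) /\ hnorm (x - y) < e.
Proof.
move=> e0; have e20 : 0 < e ^+ 2 by rewrite exprn_gt0.
have x0 s : 0 <= normc (x s) ^+ 2 by exact: sqr_ge0.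
have [X uX ltX] := tsum_approx x0 (square_summable_coord x) e20.
have [y yE] : exists y : H, forall s, y s = if s \in X then x s else 0.
  apply: ell2_exists; apply: (square_summable_dom (C := 1)) (square_summable_coord x).
    exact: ler01.
  by move=> s; case: ifP => _; rewrite mul1r ?normc0 ?normc_ge0.
exists X, y; split => //.
have split : sqn x = (sqn y + sqn (x - y)%R)%E.
  rewrite -tsumD; [|by move=> s; exact: sqr_ge0|by move=> s; exact: sqr_ge0].
  congr tsum; apply/funext => s; rewrite ell2DE ell2NE yE.
  by case: ifP => _; rewrite ?subrr ?subr0 normc0 expr0n /= ?addr0 ?add0r.
have sqy : sqn y = (\sum_(s <- X) normc (x s) ^+ 2)%:E.
  rewrite -tsum_seq //; congr tsum; apply/funext => s; rewrite yE.
  by case: ifP => _ //; rewrite normc0 expr0n.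
move: split ltX; rewrite -/(sqn x) -sqy !sqnE => -[split].
rewrite -EFinB lte_fin => ltX.
rewrite -(@ltr_pXn2r _ 2) ?nnegrE ?hnorm_ge0 ?ltW //.
by move: split ltX; rewrite !expr2; lra.
Qed.

Lemma diag_densely_defined d : densely_defined (diag d).
Proof.
move=> x e /(truncation x) [X [y [yE lt]]]; exists y => //.
(* On a finite set [d] is bounded by the sum of its values. *)
pose C := \sum_(s <- X) `|d s|.
have [z zE] : exists z : H, forall s, z s = (d s)%:C%C * y s.
  apply: ell2_exists; apply: (square_summable_dom (C := C)) (square_summable_coord y).
    by apply: sumr_ge0.
  move=> s; rewrite yE normcM normc_real; case: ifP => [sX|_]; last first.
    by rewrite normc0 !mulr0.
  rewrite ler_wpM2r ?normc_ge0 // /C (big_rem s) //= lerDl.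
  by apply: sumr_ge0.
by exists z.
Qed.

(** The basis vectors lie in the domain, and pairing with them determines every
    coordinate of a vector of the domain of the adjoint. *)
Lemma diag_adj d : op_adj (diag d) = diag d.
Proof.
apply/seteqP; split=> -[u v] /= h.
  apply/diagP => t; have := h _ _ (diag_delta d t).
  rewrite innerZl !inner_delta_l => /(congr1 (@conjc R)).
  by rewrite conjcM !conjcK conjc_real /= => ->.
move=> x y /diagP xy; move/diagP : h => h.
by apply: eq_complex_sum => s; rewrite xy h conjcM conjc_real; ring.
Qed.

Lemma diag_self_adjoint d : self_adjoint (diag d).
Proof.
by split; [exact: diag_linear | exact: diag_densely_defined | exact: diag_adj].
Qed.

Lemma diag_positive d : (forall t, 0 <= d t) -> positive (diag d).
Proof.
move=> d0; split; first exact: diag_self_adjoint.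
move=> x y /diagP xy; rewrite /inner /complex_sum.
have E s : y s * (x s)^*%C = (d s * normc (x s) ^+ 2)%:C%C.
  by rewrite xy -mulrA mulcJ real_complexM.
rewrite lecE /=; apply/andP; split.
  apply/eqP; rewrite real_sum_ge0 ?tsum0 // => s; by rewrite E.
rewrite real_sum_ge0 => [|s]; last by rewrite E /= mulr_ge0 ?sqr_ge0.
by rewrite fine_ge0 // tsum_ge0 // => s; rewrite E /= mulr_ge0 ?sqr_ge0.
Qed.

Lemma diag_is_abs d : (forall t, 0 <= d t) -> is_abs (diag d) (diag d).
Proof. by move=> d0; split; [exact: diag_positive | rewrite diag_adj]. Qed.

(** The natural domain of the product is that of [fun t => d t * e t] because [d]
    is bounded below: the intermediate vector is dominated by the final one. *)
Lemma diag_comp d e : (forall t, 1 <= `|d t|) ->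
  op_comp (diag d) (diag e) = diag (fun t => d t * e t).
Proof.
move=> d1; apply/seteqP; split=> -[x z].
  move=> [y /diagP /= xy /diagP /= yz]; apply/diagP => t.
  by rewrite yz xy real_complexM mulrA.
move=> /diagP xz; have [y yE] : exists y : H, forall t, y t = (e t)%:C%C * x t.
  apply: ell2_exists; apply: (square_summable_dom (C := 1)) (square_summable_coord z).
    exact: ler01.
  move=> t; rewrite mul1r xz real_complexM -mulrA [leRHS]normcM normc_real.
  by rewrite ler_peMl ?normc_ge0.
by exists y; apply/diagP => t //=; rewrite yE xz real_complexM mulrA.
Qed.

Lemma diag_inv d : (forall t, d t != 0) -> op_inv (diag d) = diag (fun t => (d t)^-1).
Proof.
move=> d0; have dC t : (d t)%:C%C != 0.
  by apply: contra (d0 t) => /eqP [->].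
apply/seteqP; split=> -[x y] /diagP /= xy; apply/diagP => t /=.
  by rewrite xy mulrA -real_complexM mulVf // mul1r.
by rewrite xy mulrA -real_complexM mulfV // mul1r.
Qed.

Lemma diag_resolvent0 d : (forall t, d t != 0) ->
  resolvent (diag d) 0 = diag (fun t => (d t)^-1).
Proof.
move=> d0; rewrite -diag_inv // /resolvent; congr op_inv.
apply/seteqP; split=> -[x z] /=.
  move=> [y [y' [xy [w _ e1]] e2]].
  have {}e1 : y' = - 0 *: w := e1; have {}e2 : z = y + y' := e2.
  by rewrite e2 e1 oppr0 scale0r addr0.
move=> xz; exists z, 0; split; rewrite ?addr0 //.
by exists x; rewrite ?oppr0 ?scale0r.
Qed.

Lemma diag_inv_off_ker d : (forall t, d t != 0) ->
  inv_off_ker (diag d) = diag (fun t => (d t)^-1).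
Proof.
move=> d0; rewrite -diag_inv //.
have ker x : op_ker (diag d) x -> x = 0.
  move=> /diagP x0; apply: ell2_ext => t; have /eqP := x0 t.
  rewrite eq_sym mulf_eq0 => /orP [/eqP[] /eqP|/eqP //].
  by rewrite (negbTE (d0 t)).
apply/seteqP; split=> -[x y] /=.
  move=> [_ [z yz /ker /eqP]]; rewrite subr_eq0 => /eqP xz.
  by have {}xz : x = z := xz; rewrite xz.
move=> yx; split.
  move=> v /ker ->; rewrite -[0 : H](scale0r (0 : H)) innerZl; exact: mul0r.
by exists x => //=; apply/diagP => t; rewrite subrr !ell20E mulr0.
Qed.

(** Write the entries as [d = d1 + d2], where [d1] is supported on the finite set
    on which [|d|] is at least [1 / (k + 1)]. A bounded sequence has a
    subsequence whose term of rank [k] is close on this finite set to a fixed [l]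
    (by [ball_cluster]), and the remaining part contributes at most
    [1 / (k + 1)] times a bounded quantity. *)
Lemma diag_compact d (C : R) : (forall t, `|d t| <= C) ->
  (forall e : R, 0 < e -> finite_set [set t | e <= `|d t|]) ->
  compact_operator (diag d).
Proof.
move=> dC fin; split; first exact: diag_bounded dC.
move=> x y xy x1; have [l l2 lcl] := ball_cluster x1.
pose r k : R := k.+1%:R^-1.
have r0 k : 0 < r k by rewrite invr_gt0.
have /choice [X XP] : forall k, exists X : seq I,
    uniq X /\ forall t, (t \in X) = (r k <= `|d t|).
  move=> k; have /finite_seqP [X XE] := fin _ (r0 k).
  exists (undup X); split; first exact: undup_uniq.
  move=> t; rewrite mem_undup; have := congr1 (fun A : set I => A t) XE => /= h.
  by apply/idP/idP; [rewrite -h | rewrite h].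
have inX k t := (XP k).2 t.
have /choice [N NP] : forall mk : nat * nat, exists n, (mk.1 <= n)%N /\
    \sum_(s <- X mk.2) normc (x n s - l s) ^+ 2 < r mk.2.
  by move=> [m k]; have [n ? ?] := lcl (X k) (r k) m (r0 k); exists n.
pose phi := fix phi k := if k is k'.+1 then N ((phi k').+1, k) else N (0%N, 0%N).
have phiP k : \sum_(s <- X k) normc (x (phi k) s - l s) ^+ 2 < r k.
  by case: k => [|k] /=; [have [_] := NP (0%N, 0%N)|have [_] := NP ((phi k).+1, k.+1)].
have [z /diagP lz] := diag_exists l dC.
have {}xy k s : y k s = (d s)%:C%C * x k s by move/diagP: (xy k).
exists phi, z; split=> [k|]; first by have [] := NP ((phi k).+1, k.+1).
(* The number 6 bounds [hnorm (x k - l)], that is [2 * (1 + 2)]. *)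
pose M := C ^+ 2 + 6 ^+ 2 : R.
have bound k : hnorm ((y \o phi) k - z) ^+ 2 <= M * r k.
  set u := x (phi k); rewrite -lee_fin -sqnE.
  pose f s := normc (u s - l s) ^+ 2.
  have f0 s : 0 <= f s by exact: sqr_ge0.
  apply: (@le_trans _ _ ((C ^+ 2)%:E * tsum (fun s => if s \in X k then f s else 0)%R
      + (r k ^+ 2)%:E * tsum f)%E).
    rewrite -!tsumZ ?sqr_ge0 // -?tsumD; last 3 first.
    - by move=> s; rewrite mulr_ge0 ?sqr_ge0 //; case: ifP.
    - by move=> s; rewrite mulr_ge0 ?sqr_ge0.
    - by move=> s; case: ifP.
    apply: tsum_le => s; rewrite ell2DE ell2NE /= xy lz /= -mulrBr normcM normc_real.
    rewrite exprMn -/(f s) inX; case: (leP (r k) `|d s|) => [h|h].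
      apply: ler_wpDr; first by rewrite mulr_ge0 ?sqr_ge0.
      rewrite ler_wpM2r // ler_pXn2r ?nnegrE //.
      exact: le_trans (dC s).
    rewrite mulr0 add0r ler_wpM2r // ler_pXn2r ?nnegrE //; exact: ltW.
  rewrite tsum_seq ?(XP k).1 //.
  have -> : tsum f = sqn (u - l) by [].
  rewrite sqnE -!EFinM -EFinD lee_fin /M mulrDl.
  have rk1 : r k <= 1 by rewrite invf_le1 ?ler1n.
  have h6 : hnorm (u - l) <= 6.
    have h := ell2_hnormD u (- l). apply: (le_trans h).
    have : hnorm (- l) <= hnorm l.
      by rewrite -[leRHS]mul1r; apply: hnorm_dom => // s; rewrite ell2NE normcN mul1r.
    by have := x1 (phi k); rewrite -/u; lra.
  apply: lerD.
    by rewrite ler_wpM2l ?sqr_ge0 // ltW // phiP.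
  have := hnorm_ge0 (u - l); have := r0 k => rk0 u0.
  have : hnorm (u - l) ^+ 2 <= 6 ^+ 2 by rewrite ler_pXn2r ?nnegrE.
  have : r k ^+ 2 <= r k by rewrite expr2 ler_piMl // ltW.
  have := sqr_ge0 (r k); have := sqr_ge0 (hnorm (u - l)).
  move: (r k ^+ 2) (hnorm (u - l) ^+ 2) => a b; nra.
apply/cvgr0Pnorm_lt => e e0.
have M0 : 0 <= M by rewrite /M; have := sqr_ge0 C; lra.
have e' : 0 < e ^+ 2 / (M + 1) by rewrite divr_gt0 ?exprn_gt0 //; lra.
near=> k.
have : r k < e ^+ 2 / (M + 1).
  by near: k; exact: (near_infty_natSinv_lt (PosNum e')).
rewrite ltr_pdivlMr; last by lra.
move=> rk; rewrite ger0_norm ?hnorm_ge0 //.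
rewrite -(@ltr_pXn2r _ 2) ?nnegrE ?hnorm_ge0 ?ltW //.
apply: le_lt_trans (bound k) _; have := r0 k; nra.
Unshelve. all: by end_near. Qed.

End diagonal.

(** * Matrices with at most one nonzero entry in each row and column *)

Section monomial.
Variables (R : realType) (I : choiceType).
Local Notation H := (ell2 R I).
Implicit Types (m : I -> I -> R) (d : I -> R) (x y u v : H).

(** These are the matrices of weighted partial permutations of the basis;
    [alpha], [beta], [A0] and [A1] are sums of at most two of them. No
    convergence question arises, since the sums giving the coordinates of the
    image have at most one nonzero term. *)
Definition monomial m : Prop :=
  (forall s t t', m s t != 0 -> m s t' != 0 -> t = t') /\
  (forall s s' t, m s t != 0 -> m s' t != 0 -> s = s').

Lemma monomial_tr m : monomial m -> monomial (fun s t => m t s).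
Proof.
by move=> [m1 m2]; split=> [s t t'|s s' t]; [exact: m2 | exact: m1].
Qed.

Lemma monomial_sub m m' : (forall s t, m s t = 0 -> m' s t = 0) ->
  monomial m -> monomial m'.
Proof.
move=> sub; have nz s t : m' s t != 0 -> m s t != 0.
  by apply: contra => /eqP /sub ->.
move=> [m1 m2]; split=> [s t t'|s s' t] /nz h /nz h'.
  exact: m1 h h'.
exact: m2 h h'.
Qed.

(** For the transposed matrix, this is a statement on rows. *)
Lemma monomial_col m t :
  (exists s, m s t != 0) \/ (forall s, m s t = 0).
Proof.
have [e|ne] := pselect (exists s, m s t != 0); [by left | right=> s].
by apply/eqP; apply: contrapT => /negP h; apply: ne; exists s.
Qed.

Definition mat_op m : graph R I :=
  [set p : H * H | forall t, p.2 t = complex_sum (fun s => p.1 s * (m s t)%:C%C)].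

Lemma mat_opP m x y : mat_op m (x, y) <->
  forall t, y t = complex_sum (fun s => x s * (m s t)%:C%C).
Proof. by []. Qed.

Lemma op_of_basisE (F : I -> H) m : (forall s t, F s t = (m s t)%:C%C) ->
  op_of_basis F = mat_op m.
Proof.
move=> Fm; apply/seteqP; split=> -[x y] h t; rewrite h /=.
  by apply: eq_complex_sum => s; rewrite Fm.
by apply: eq_complex_sum => s; rewrite Fm.
Qed.

Lemma monomial_sum m (x : I -> R[i]) s t : monomial m -> m s t != 0 ->
  complex_sum (fun s => x s * (m s t)%:C%C) = x s * (m s t)%:C%C.
Proof.
move=> [_ m2] st; apply: complex_sum_single => s' s's.
have [->|h] := eqVneq (m s' t) 0; first by rewrite mulr0.
by rewrite (m2 _ _ _ h st) eqxx in s's.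
Qed.

Lemma monomial_sum0 m (x : I -> R[i]) t : (forall s, m s t = 0) ->
  complex_sum (fun s => x s * (m s t)%:C%C) = 0.
Proof. by move=> h; apply: complex_sum0 => s; rewrite h mulr0. Qed.

Lemma monomial_summable m (x : I -> R[i]) t : monomial m ->
  abs_summable (fun s => x s * (m s t)%:C%C).
Proof.
move=> [_ m2]; have [[s st]|h] := monomial_col m t.
  apply: (@abs_summable_single _ _ _ s) => s' s's.
  have [->|h] := eqVneq (m s' t) 0; first by rewrite mulr0.
  by rewrite (m2 _ _ _ h st) eqxx in s's.
rewrite /abs_summable tsum0 ?ltry // => s; by rewrite h mulr0 normc0.
Qed.

(** Both sums reduce to the supports, which [E] puts in bijection. *)
Lemma esum_reindex (E : I -> I -> Prop) (f g : I -> \bar R) :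
  (forall s t t', E s t -> E s t' -> t = t') ->
  (forall s s' t, E s t -> E s' t -> s = s') ->
  (forall s t, E s t -> f s = g t) ->
  (forall s, f s <> 0%E -> exists t, E s t) ->
  (forall t, g t <> 0%E -> exists s, E s t) ->
  (\esum_(s in [set: I]) f s = \esum_(t in [set: I]) g t)%E.
Proof.
move=> E1 E2 fg f0 g0.
(* The partial bijection as a function, extended by the identity off its domain. *)
have /choice [h hE] : forall s, exists t, (exists t, E s t) -> E s t.
  move=> s; have [[t st]|ne] := pselect (exists t, E s t); first by exists t.
  by exists s.
pose P := [set s | exists t, E s t]; pose Q := [set t | exists s, E s t].
have supp (k : I -> \bar R) A : (forall s, k s <> 0%E -> A s) ->
    (\esum_(s in [set: I]) k s = \esum_(s in A) k s)%E.
  move=> kA; rewrite [RHS]esum_mkcond; apply: eq_esum => s _.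
  case: ifPn => // /negP; rewrite inE => nA.
  by apply: contrapT => /kA.
rewrite (supp f P) // (supp g Q) // (@reindex_esum _ _ _ P Q h).
  by apply: eq_esum => s Ps; apply: fg; apply: hE.
split.
- by move=> s Ps; exists s; exact: hE.
- move=> s s'; rewrite !inE => Ps Ps' hh.
  by apply: (E2 _ _ (h s)); [exact: hE | rewrite hh; exact: hE].
- move=> t [s st]; exists s; first by exists t.
  by apply: (E1 s _ _ _ st); apply: hE; exists t.
Qed.

Lemma complex_sum_reindex (E : I -> I -> Prop) (f g : I -> R[i]) :
  (forall s t t', E s t -> E s t' -> t = t') ->
  (forall s s' t, E s t -> E s' t -> s = s') ->
  (forall s t, E s t -> f s = g t) ->
  (forall s, f s != 0 -> exists t, E s t) ->
  (forall t, g t != 0 -> exists s, E s t) ->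
  complex_sum f = complex_sum g.
Proof.
move=> E1 E2 fg f0 g0.
have key (h : R[i] -> R) (k : R -> \bar R) : h 0 = 0 -> k 0 = 0%E ->
    (\esum_(s in [set: I]) k (h (f s)) = \esum_(s in [set: I]) k (h (g s)))%E.
  move=> h0 k0; apply: (esum_reindex E1 E2) => [s t /fg -> //|s kf|t kg].
    by apply: f0; apply/eqP => fs; apply: kf; rewrite fs h0.
  by apply: g0; apply/eqP => gt; apply: kg; rewrite gt h0.
have rkey (h : R[i] -> R) : h 0 = 0 ->
    real_sum (fun s => h (f s)) = real_sum (fun s => h (g s)).
  move=> h0; rewrite /real_sum; congr (fine (_ - _)%E).
    transitivity (\esum_(s in [set: I]) maxe (h (f s))%:E 0)%E.
      by apply: eq_esum => s _; rewrite funeposE.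
    rewrite (key h (fun r => maxe r%:E 0%E)) ?maxxx //.
    by apply: eq_esum => s _; rewrite funeposE.
  transitivity (\esum_(s in [set: I]) maxe (- (h (f s))%:E) 0)%E.
    by apply: eq_esum => s _; rewrite funenegE.
  rewrite (key h (fun r => maxe (- r%:E)%E 0%E)) ?oppe0 ?maxxx //.
  by apply: eq_esum => s _; rewrite funenegE.
by rewrite /complex_sum (rkey (@complex.Re R)) // (rkey (@complex.Im R)).
Qed.

(** Both sides are sums over the positions of the nonzero entries of [m]. They
    are reindexed, not estimated, so the weights may be unbounded. *)
Lemma mat_op_adjoint m x y u v : monomial m ->
  mat_op m (x, y) -> mat_op (fun s t => m t s) (u, v) ->
  inner y u = inner x v.
Proof.
move=> mm /mat_opP xy /mat_opP uv; have mt := monomial_tr mm.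
have yE s t : m s t != 0 -> y t = x s * (m s t)%:C%C.
  by move=> st; rewrite xy (monomial_sum _ mm st).
have vE s t : m s t != 0 -> v s = u t * (m s t)%:C%C.
  by move=> st; rewrite uv (@monomial_sum _ u _ _ mt st).
apply/esym; apply: (complex_sum_reindex (E := fun s t => m s t != 0)).
- exact: mm.1.
- exact: mm.2.
- by move=> s t st; rewrite (yE _ _ st) (vE _ _ st) conjcM conjc_real; ring.
- move=> s vs; have [//|h] := monomial_col (fun t s => m s t) s.
  by move: vs; rewrite uv (@monomial_sum0 (fun t s => m s t)) // conjc0 mulr0 eqxx.
- move=> t yt; have [//|h] := monomial_col m t.
  by move: yt; rewrite xy monomial_sum0 // mul0r eqxx.
Qed.

Lemma mat_op_delta m s t : monomial m -> m s t != 0 ->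
  mat_op m (delta R s, (m s t)%:C%C *: delta R t).
Proof.
move=> mm st; apply/mat_opP => t'; rewrite ell2ZE /=.
have [->|tt'] := eqVneq t' t.
  by rewrite (monomial_sum _ mm st) /= ?eqxx mulrC.
rewrite mulr0 complex_sum0 // => s'.
have [->|] := eqVneq s' s; last by rewrite mul0r.
have [->|h] := eqVneq (m s t') 0; first by rewrite mulr0.
by move: tt'; rewrite (mm.1 _ _ _ h st) eqxx.
Qed.

Lemma mat_op_delta0 m s : (forall t, m s t = 0) -> mat_op m (delta R s, 0).
Proof.
move=> ms; apply/mat_opP => t; rewrite ell20E complex_sum0 // => s' /=.
by have [->|] := eqVneq s' s; rewrite ?ms ?mulr0 ?mul0r.
Qed.

(** The natural domain is the right one for an unbounded monomial matrix: testing
    against the basis vectors computes the coordinates of a vector of the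
    adjoint, and the converse is [mat_op_adjoint]. *)
Lemma mat_op_adj m : monomial m -> op_adj (mat_op m) = mat_op (fun s t => m t s).
Proof.
move=> mm; apply/seteqP; split=> -[u v] h; last first.
  by move=> x y xy; exact: mat_op_adjoint xy h.
have {}h x y : mat_op m (x, y) -> inner y u = inner x v by exact: h.
have mt := monomial_tr mm.
apply/mat_opP => s; have [[t st]|ms] := monomial_col (fun t s => m s t) s.
  rewrite (@monomial_sum _ u _ _ mt st).
  have := h _ _ (mat_op_delta mm st); rewrite innerZl !inner_delta_l.
  by move=> /(congr1 (@conjc R)); rewrite conjcM !conjcK conjc_real mulrC => ->.
rewrite (@monomial_sum0 (fun t s => m s t)) //; have := h _ _ (mat_op_delta0 ms).
rewrite inner_delta_l => vs; apply: (can_inj (@conjcK R)).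
rewrite -vs conjc0 -[0 : H](scale0r (0 : H)) innerZl; exact: mul0r.
Qed.

Lemma mat_op_exists m x (C : R) : monomial m -> 0 <= C ->
  (forall s t, `|m s t| <= C) ->
  exists2 y, mat_op m (x, y) & hnorm y <= C * hnorm x.
Proof.
move=> mm C0 mC; pose f t := complex_sum (fun s => x s * (m s t)%:C%C).
(* [r s] is the absolute value of the nonzero entry of the row [s], if any. *)
have /choice [r rP] : forall s, exists r : R, [/\ 0 <= r, r <= C,
    (forall t, m s t != 0 -> r = `|m s t|) & (r != 0 -> exists t, m s t != 0)].
  move=> s; have [[t st]|ms] := monomial_col (fun t s => m s t) s.
    exists `|m s t|; split=> // [t' st'|_]; last by exists t.
    by rewrite (mm.1 _ _ _ st st').
  by exists 0; split=> // [t|]; rewrite ?ms eqxx.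
have le : (sqn f <= (C ^+ 2)%:E * sqn x)%E.
  rewrite -tsumZ ?sqr_ge0 // => [|s]; last exact: sqr_ge0.
  apply: (@le_trans _ _ (tsum (fun s => ((r s * normc (x s)) ^+ 2)%R))); last first.
    apply: tsum_le => s; rewrite exprMn ler_wpM2r ?sqr_ge0 //.
    by have [r0 rC _ _] := rP s; rewrite ler_pXn2r ?nnegrE.
  rewrite le_eqVlt; apply/orP; left; apply/eqP; apply/esym.
  apply: (esum_reindex (E := fun s t => m s t != 0)).
  - exact: mm.1.
  - exact: mm.2.
  - move=> s t st; have [_ _ /(_ _ st) -> _] := rP s.
    by rewrite /f (monomial_sum _ mm st) normcM normc_real mulrC.
  - move=> s rx; have [_ _ _ /(_ _)] := rP s; apply; apply/eqP => rs.
    by apply: rx; rewrite rs mul0r expr0n.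
  - move=> t ft; have [//|h] := monomial_col m t.
    by case: ft; rewrite /f monomial_sum0 // normc0 expr0n.
have [y yE] : exists y : H, forall t, y t = f t.
  apply: ell2_exists; apply: le_lt_trans le _.
  by rewrite lte_mul_pinfty ?lee_fin ?sqr_ge0 //; exact: square_summable_coord.
exists y; first exact/mat_opP.
apply: hnorm_le; first by rewrite mulr_ge0 ?hnorm_ge0.
rewrite (_ : sqn y = sqn f); last by congr sqn; apply/funext.
by apply: le_trans le _; rewrite sqnE -EFinM exprMn.
Qed.

Lemma mat_op_fun m x y y' : mat_op m (x, y) -> mat_op m (x, y') -> y = y'.
Proof.
by move=> /mat_opP xy /mat_opP xy'; apply: ell2_ext => t; rewrite xy xy'.
Qed.

Lemma mat_op_add m x x' y y' : monomial m ->
  mat_op m (x, y) -> mat_op m (x', y') -> mat_op m (x + x', y + y').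
Proof.
move=> mm /mat_opP xy /mat_opP xy'; apply/mat_opP => t.
rewrite ell2DE xy xy' -complex_sumD; try exact: monomial_summable.
by apply: eq_complex_sum => s; rewrite ell2DE mulrDl.
Qed.

Lemma mat_opD m m' x y y' : monomial m -> monomial m' ->
  mat_op m (x, y) -> mat_op m' (x, y') ->
  mat_op (fun s t => m s t + m' s t) (x, y + y').
Proof.
move=> mm mm' /mat_opP xy /mat_opP xy'; apply/mat_opP => t.
rewrite ell2DE xy xy' -complex_sumD; try exact: monomial_summable.
by apply: eq_complex_sum => s; rewrite -mulrDr -rmorphD.
Qed.

Lemma resolventP d z x y : resolvent (diag d) z (x, y) <->
  forall t, x t = ((d t)%:C%C - z) * y t.
Proof.
split.
  move=> [y1 [y2 [/diagP yy1 [w wy e2]] e1]] t.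
  have {}e2 : y2 = - z *: w := e2; have {}e1 : x = y1 + y2 := e1.
  have {}wy : w = y := wy.
  by rewrite e1 e2 wy ell2DE ell2ZE yy1 mulrDl.
move=> h; exists (x + z *: y), (- z *: y); split.
- by apply/diagP => t; rewrite ell2DE ell2ZE h; ring.
- by exists y.
- by rewrite /= -addrA -scalerDl subrr scale0r addr0.
Qed.

(** Otherwise [delta t] would be in the kernel of [diag d - z]. *)
Lemma resolvent_set_neq d z t : resolvent_set (diag d) z -> (d t)%:C%C - z != 0.
Proof.
move=> [[_ _ fn] _ _]; apply/eqP => dz.
have : delta R t = 0.
  apply: (fn 0); apply/resolventP => s; rewrite ell20E; last by rewrite mulr0.
  rewrite /=; have [->|_] := eqVneq s t; last by rewrite mulr0.
  by rewrite dz mul0r.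
move/(congr1 (fun u : H => u t)) => /eqP.
by rewrite /= eqxx oner_eq0.
Qed.

(** The resolvent multiplies the coordinate [t] by [(d t - z)^-1], and the matrix
    only links coordinates which have the same [d]. *)
Lemma mat_op_commutes d m : monomial m -> (forall s t, m s t != 0 -> d s = d t) ->
  commutes_with (diag d) (mat_op m).
Proof.
move=> mm dm z zr [x y] [u /mat_opP xu /resolventP uy].
have [v xv] : exists v, resolvent (diag d) z (x, v).
  have [_ domT _] := zr; have : [set: H] x by [].
  by rewrite -domT.
exists v => //; apply/mat_opP => t; move/resolventP: xv => xv.
have rt := resolvent_set_neq t zr; have ut := uy t.
apply: (mulfI rt); rewrite -ut /= xu.
have [[s st]|ms] := monomial_col m t; last by rewrite !monomial_sum0 ?mulr0.
by rewrite !(monomial_sum _ mm st) xv (dm _ _ st) mulrA.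
Qed.

End monomial.

(** * Operators with bounded commutators *)

Section regular.
Variables (R : realType) (I : choiceType) (d : I -> R).
Local Notation H := (ell2 R I).
Implicit Types (f g : H -> H) (T : graph R I).

(** Bounded operators, as functions, which preserve the domain of [diag d] and
    have a bounded commutator with it. One constant serves for both bounds. *)
Definition smooth f : Prop := exists C : R, [/\ 0 <= C,
  forall x y : H, f (x + y) = f x + f y,
  forall x, hnorm (f x) <= C * hnorm x &
  forall x x', diag d (x, x') ->
    exists2 y', diag d (f x, y') & hnorm (y' - f x') <= C * hnorm x].

Definition fun_graph f : graph R I := [set p | p.2 = f p.1].

(** The adjoint is carried along as a second smooth function, because a bounded
    commutator is not obviously inherited by the adjoint of an abstract operator. *)
Definition regular T : Prop := exists f g,
  [/\ T = fun_graph f, smooth f, smooth g &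
      forall x y, inner (f x) y = inner x (g y)].

Lemma smooth_id : smooth id.
Proof.
exists 1; split=> // [x|x x' xx']; first by rewrite mul1r.
exists x' => //; rewrite subrr mul1r -[0 : H](scale0r (0 : H)).
by apply: le_trans (ell2_hnormZ _ _) _; rewrite normc0 mul0r hnorm_ge0.
Qed.

Lemma smooth_scale (z : R[i]) f : smooth f -> smooth (fun x => z *: f x).
Proof.
move=> [C [C0 fD fC fd]]; exists (normc z * C); split.
- by rewrite mulr_ge0 ?normc_ge0.
- by move=> x y; rewrite fD scalerDr.
- move=> x; apply: le_trans (ell2_hnormZ _ _) _.
  by rewrite -mulrA ler_wpM2l ?normc_ge0.
- move=> x x' /fd [y' /diagP xy' yC]; exists (z *: y').
    by apply/diagP => t; rewrite !ell2ZE xy'; ring.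
  rewrite -scalerBr; apply: le_trans (ell2_hnormZ _ _) _.
  by rewrite -mulrA ler_wpM2l ?normc_ge0.
Qed.

Lemma smooth_add f g : smooth f -> smooth g -> smooth (fun x => f x + g x).
Proof.
move=> [C [C0 fD fC fd]] [C' [C0' gD gC gd]]; exists (2 * (C + C')); split.
- by rewrite mulr_ge0 ?addr_ge0.
- by move=> x y; rewrite fD gD addrACA.
- move=> x; apply: le_trans (ell2_hnormD _ _) _.
  by have := fC x; have := gC x; lra.
- move=> x x' xx'; have [y' /diagP xy' yC] := fd _ _ xx'.
  have [w' /diagP xw' wC] := gd _ _ xx'; exists (y' + w').
    by apply/diagP => t; rewrite !ell2DE xy' xw'; ring.
  rewrite opprD addrACA; apply: le_trans (ell2_hnormD _ _) _.
  by lra.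
Qed.

(** The Leibniz rule [[D, f g] = [D, f] g + f [D, g]]. *)
Lemma smooth_comp f g : smooth f -> smooth g -> smooth (f \o g).
Proof.
move=> [C [C0 fD fC fd]] [C' [C0' gD gC gd]].
have CC (u v : H) : hnorm u <= C' * hnorm v -> C * hnorm u <= C * C' * hnorm v.
  by move=> uv; rewrite -mulrA ler_wpM2l.
have C4 (u v : H) :
    hnorm u <= C * C' * hnorm v -> hnorm u <= 4 * (C * C') * hnorm v.
  have : 0 <= C * C' * hnorm v by rewrite !mulr_ge0 ?hnorm_ge0.
  by lra.
(* The factor 4 is 2, from [ell2_hnormD], times the two terms of the Leibniz rule. *)
exists (4 * (C * C')); split.
- by rewrite !mulr_ge0.
- by move=> x y /=; rewrite gD fD.
- by move=> x; apply: C4; apply: le_trans (fC _) _; exact: CC.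
- move=> x x' xx'; have [y' xy' yC] := gd _ _ xx'.
  have [z' yz' zC] := fd _ _ xy'; exists z' => //=.
  have -> : z' - f (g x') = (z' - f y') + f (y' - g x').
    have -> : f y' = f (y' - g x') + f (g x') by rewrite -fD subrK.
    by rewrite opprD addrA addrAC subrK.
  apply: le_trans (ell2_hnormD _ _) _.
  have := CC _ _ (gC x); have := CC _ _ yC; have := fC (y' - g x').
  by lra.
Qed.

Lemma regular_adj f g : (forall x y, inner (f x) y = inner x (g y)) ->
  op_adj (fun_graph f) = fun_graph g.
Proof.
move=> fg; apply/seteqP; split=> -[u v] h.
  apply: inner_ext => w; rewrite -fg; apply/esym; exact: h.
move=> x y xy; have {}xy : y = f x := xy; have {}h : v = g u := h.
by rewrite /= xy h fg.
Qed.

(** It is enough to control the generators: the regular operators form a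
    star-algebra, with the adjoint operation exchanging the two functions. *)
Lemma regular_star (G : set (graph R I)) T : G `<=` regular ->
  star_subalgebra_gen G T -> regular T.
Proof.
move=> GR; elim=> {T} [T /GR //||z T _ [f [g [-> fs gs fg]]]
  |S T _ [f [g [-> fs gs fg]]] _ [f' [g' [-> fs' gs' fg']]]
  |S T _ [f [g [-> fs gs fg]]] _ [f' [g' [-> fs' gs' fg']]]
  |T _ [f [g [-> fs gs fg]]]].
- by exists id, id; split=> //; exact: smooth_id.
- exists (fun x => z *: f x), (fun x => z^*%C *: g x); split.
  + apply/seteqP; split=> -[x y].
      move=> [w xw yw]; have {}xw : w = f x := xw; have {}yw : y = z *: w := yw.
      by rewrite yw xw.
    by move=> h; exists (f x).
  + exact: smooth_scale.
  + exact: smooth_scale.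
  + by move=> x y; rewrite innerZl innerZr conjcK fg.
- exists (fun x => f x + f' x), (fun x => g x + g' x); split.
  + apply/seteqP; split=> -[x y].
      move=> [w [w' [xw xw' yw]]].
      have {}xw : w = f x := xw; have {}xw' : w' = f' x := xw'.
      by have {}yw : y = w + w' := yw; rewrite yw xw xw'.
    by move=> h; exists (f x), (f' x).
  + exact: smooth_add.
  + exact: smooth_add.
  + by move=> x y; rewrite innerDl innerDr fg fg'.
- exists (f \o f'), (g' \o g); split.
  + apply/seteqP; split=> -[x y].
      move=> [w xw wy]; have {}xw : w = f' x := xw.
      by have {}wy : y = f w := wy; rewrite wy xw.
    by move=> h; exists (f' x).
  + exact: smooth_comp.
  + exact: smooth_comp.
  + by move=> x y /=; rewrite fg fg'.
- exists g, f; split=> //; first exact: regular_adj.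
  by move=> x y; rewrite innerC -fg -innerC.
Qed.

Lemma regular_commutator T : regular T -> bounded_commutator (diag d) T.
Proof.
move=> [f [g [-> [C [C0 fD fC fd]] _ _]]]; split.
  move=> x [x' xx']; have [y' xy' _] := fd _ _ xx'.
  exists (y' + (-1) *: f x'), y', ((-1) *: f x'); split=> //.
    by exists (f x).
  by exists (f x') => //; exists x'.
exists C => x y [y1 [y2 [[w xw wy1] [w' [x' xx' xw'] e2] e1]]].
have {}xw : w = f x := xw; have {}xw' : w' = f x' := xw'.
have {}e1 : y = y1 + y2 := e1; have {}e2 : y2 = -1 *: w' := e2.
have [y' xy' yC] := fd _ _ xx'.
have [_ _ fn] := diag_linear d.
have -> : y = y' - f x'; last by [].
rewrite e1 e2 xw' scaleN1r; congr (_ + _); apply: fn xy'.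
by move: wy1; rewrite xw.
Qed.

(** The commutator is again monomial, with entries [(d t - d s) * m s t]: it is
    bounded as soon as [m] is bounded and moves [d] by a bounded amount. *)
Lemma mat_op_smooth m (C C' : R) : monomial m -> 0 <= C -> 0 <= C' ->
  (forall s t, `|m s t| <= C) ->
  (forall s t, m s t != 0 -> `|d t - d s| <= C') ->
  exists2 f, smooth f & mat_op m = fun_graph f.
Proof.
move=> mm C0 C'0 mC dC.
have /choice [f fP] : forall x : H, exists y,
    mat_op m (x, y) /\ hnorm y <= C * hnorm x.
  by move=> x; have [y ? ?] := mat_op_exists x mm C0 mC; exists y.
exists f; last first.
  apply/seteqP; split=> -[x y].
    by move=> xy; apply: mat_op_fun xy (fP x).1.
  by move=> xy; have {}xy : y = f x := xy; rewrite xy; exact: (fP x).1.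
(* The matrix of the commutator. *)
pose m' s t := (d t - d s) * m s t.
have mm' : monomial m' by apply: monomial_sub mm => s t; rewrite /m' => ->; rewrite mulr0.
have CC0 : 0 <= C' * C by rewrite mulr_ge0.
have mC' s t : `|m' s t| <= C' * C.
  have [h|h] := eqVneq (m s t) 0; first by rewrite /m' h mulr0 normr0.
  by rewrite normrM ler_pM // dC.
exists (C + C' * C); split.
- exact: addr_ge0.
- move=> x y; apply: mat_op_fun (fP _).1 _.
  exact: mat_op_add mm (fP _).1 (fP _).1.
- move=> x; apply: le_trans (fP x).2 _.
  by rewrite ler_wpM2r ?hnorm_ge0 // lerDl.
- move=> x x' /diagP xx'; have [w /mat_opP xw wC] := mat_op_exists x mm' CC0 mC'.
  exists (f x' + w); last first.
    rewrite addrAC subrr add0r; apply: le_trans wC _.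
    by rewrite ler_wpM2r ?hnorm_ge0 // lerDr.
  have /mat_opP fx := (fP x).1; have /mat_opP fx' := (fP x').1.
  apply/diagP => t; rewrite ell2DE fx fx' xw.
  have [[s st]|h] := monomial_col m t; last first.
    by rewrite !monomial_sum0 ?mulr0 ?addr0 // => s; rewrite /m' h mulr0.
  rewrite !(monomial_sum _ mm st) (@complex_sum_single _ _ _ s).
    by rewrite xx' /m' real_complexM rmorphB /=; ring.
  move=> s' s's; rewrite /m'; have [->|st'] := eqVneq (m s' t) 0; rewrite ?mulr0 //.
  by rewrite (mm.2 _ _ _ st' st) eqxx in s's.
Qed.

Lemma mat_op_regular m (C C' : R) : monomial m -> 0 <= C -> 0 <= C' ->
  (forall s t, `|m s t| <= C) ->
  (forall s t, m s t != 0 -> `|d t - d s| <= C') ->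
  regular (mat_op m).
Proof.
move=> mm C0 C'0 mC dC; have [f fs fE] := mat_op_smooth mm C0 C'0 mC dC.
have dC' s t : m s t != 0 -> `|d s - d t| <= C' by rewrite distrC; exact: dC.
have [g gs gE] := @mat_op_smooth (fun s t => m t s) C C' (monomial_tr mm) C0 C'0
  (fun s t => mC t s) (fun s t st => dC' t s st).
exists f, g; split=> // x y; apply: (mat_op_adjoint mm).
  by rewrite fE.
by rewrite gE.
Qed.

Lemma mat_op_regularD m m' : monomial m -> monomial m' ->
  regular (mat_op m) -> regular (mat_op m') ->
  regular (mat_op (fun s t => m s t + m' s t)).
Proof.
move=> mm mm' [f [g [fE fs gs fg]]] [f' [g' [fE' fs' gs' fg']]].
have F x : mat_op m (x, f x) by rewrite fE.
have F' x : mat_op m' (x, f' x) by rewrite fE'.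
exists (fun x => f x + f' x), (fun x => g x + g' x); split.
- apply/seteqP; split=> -[x y].
    by move=> xy; apply: mat_op_fun xy _; exact: mat_opD.
  move=> xy; have {}xy : y = f x + f' x := xy.
  by rewrite xy; exact: mat_opD.
- exact: smooth_add.
- exact: smooth_add.
- by move=> x y; rewrite innerDl innerDr fg fg'.
Qed.

End regular.

(** * Enumerating the basis layer by layer *)

Section enumeration.
Local Open Scope nat_scope.

(** The number of basis vectors [e^(n)_(i, j)] with [2n < N], since the layer [2n]
    has [(2n + 1)^2] elements. *)
Definition layer_start N := \sum_(m < N) m.+1 ^ 2.

Lemma layer_startS N : layer_start N.+1 = layer_start N + N.+1 ^ 2.
Proof. by rewrite /layer_start big_ord_recr. Qed.

Lemma layer_start_le M N : M <= N -> layer_start M <= layer_start N.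
Proof.
elim: N => [|N IH]; first by rewrite leqn0 => /eqP ->.
rewrite leq_eqVlt => /orP[/eqP -> //|]; rewrite ltnS => /IH h.
by rewrite layer_startS (leq_trans h) // leq_addr.
Qed.

(** This cubic growth is the source of the summability exponent 3. *)
Lemma layer_start_cube N : layer_start N <= N ^ 3.
Proof.
elim: N => [|N IH]; first by rewrite /layer_start big_ord0.
rewrite layer_startS; apply: leq_trans (leq_add IH (leqnn _)) _.
by rewrite expnS [N.+1 ^ 3]expnS mulSn addnC leq_add2l leq_mul // leq_sqr.
Qed.

Lemma layer_start_ge N : N <= layer_start N.
Proof.
elim: N => [//|N IH]; rewrite layer_startS -[leqLHS]addn1.
by rewrite leq_add ?expn_gt0.
Qed.

(** Position in the enumeration which lists the layers by increasing [2n], and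
    each layer in lexicographic order. *)
Definition rank (s : suq2_index) :=
  layer_start (tag s) + (nat_of_ord (tagged s).1 * (tag s).+1 + (tagged s).2).

Lemma rank_ge s : layer_start (tag s) <= rank s. Proof. exact: leq_addr. Qed.

Lemma rank_lt s : rank s < layer_start (tag s).+1.
Proof.
case: s => N [a b]; rewrite /rank layer_startS ltn_add2l /=.
rewrite (@leq_trans (a.+1 * N.+1)) //; first by rewrite mulSn addnC ltn_add2r.
by rewrite -mulnn leq_mul2r ltn_ord orbT.
Qed.

Lemma rank_tag s t : rank s <= rank t -> tag s <= tag t.
Proof.
move=> st; rewrite leqNgt; apply/negP => ts; move: st; rewrite leqNgt => /negP[].
by apply: leq_trans (rank_lt t) (leq_trans (layer_start_le ts) (rank_ge s)).
Qed.

Lemma rank_inj : injective rank.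
Proof.
move=> s t st.
have : tag s = tag t by apply/eqP; rewrite eqn_leq !rank_tag ?st.
case: s st => N [a b]; case: t => M [a' b'] /= st NM; subst M.
move/eqP: st; rewrite /rank /= eqn_add2l => /eqP st.
have ab (c d : 'I_N.+1) : (c * N.+1 + d) %/ N.+1 = c.
  by rewrite divnMDl // divn_small ?addn0 // ltn_ord.
have ba (c d : 'I_N.+1) : (c * N.+1 + d) %% N.+1 = d.
  by rewrite modnMDl modn_small // ltn_ord.
have /val_inj -> : a = a' :> nat by rewrite -(ab a b) st ab.
by have /val_inj -> : b = b' :> nat by rewrite -(ba a b) st ba.
Qed.

Lemma rank_surj k : exists s, rank s = k.
Proof.
have [N] : exists N, k < layer_start N by exists k.+1; exact: layer_start_ge.
elim: N => [|N IH]; first by rewrite /layer_start big_ord0.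
have [/IH //|kN] := ltnP k (layer_start N).
rewrite layer_startS -ltn_subLR // => rk.
have a : (k - layer_start N) %/ N.+1 < N.+1 by rewrite ltn_divLR // mulnn.
have b : (k - layer_start N) %% N.+1 < N.+1 by rewrite ltn_pmod.
exists (Tagged (fun N => ('I_N.+1 * 'I_N.+1)%type) (Ordinal a, Ordinal b)).
by rewrite /rank /= -divn_eq subnKC.
Qed.

Lemma rank_enum : exists e : nat -> suq2_index,
  (forall k, rank (e k) = k) /\ (forall s, e (rank s) = s).
Proof.
have /choice [e eP] := rank_surj; exists e; split=> // s.
by apply: rank_inj; rewrite eP.
Qed.

(** Hence the diagonal entry [(2n + 1)^-3] of rank [k] is at most [1 / (k + 1)]. *)
Lemma rank_cube s : (rank s).+1 <= (tag s).+1 ^ 3.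
Proof. exact: leq_trans (rank_lt s) (layer_start_cube _). Qed.

Lemma finite_layers K : finite_set [set s : suq2_index | tag s < K].
Proof.
have [e [_ es]] := rank_enum.
apply: (sub_finite_set (B := e @` [set k | k < K ^ 3])); last first.
  exact/finite_image/finite_II.
move=> s sK; exists (rank s); last exact: es.
by apply: leq_trans (rank_cube s) _; rewrite leq_exp2r.
Qed.

End enumeration.

(** * Bounds for the matrix coefficients *)

Section coefficients.
Variables (R : realType) (q : R) (hq0 : 0 < q) (hq1 : q < 1).
Implicit Types (n i j : R).

Lemma powR_anti (x y : R) : x <= y -> q `^ y <= q `^ x.
Proof. by move=> xy; apply: ger_powR => //; rewrite hq0 ltW. Qed.

Lemma powR_le1 (x : R) : 0 <= x -> q `^ x <= 1.
Proof. by move=> x0; rewrite -(powRr0 q) powR_anti. Qed.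

(** If [U] or [V] is zero, the quotient is zero by convention; this happens for
    the lowering coefficients at [n = 0]. *)
Lemma sqrt_ratio_le1 (c u v U V : R) : 0 <= c <= 1 ->
  0 <= u <= U -> 0 <= v <= V -> `|Num.sqrt (c * (u * v) / (U * V))| <= 1.
Proof.
move=> /andP[c0 c1] /andP[u0 uU] /andP[v0 vV].
rewrite ger0_norm ?sqrtr_ge0 // -sqrtr1 ler_wsqrtr //.
have uv : c * (u * v) <= U * V.
  apply: (@le_trans _ _ (1 * (u * v))); first by rewrite ler_wpM2r ?mulr_ge0.
  by rewrite mul1r ler_pM.
have := mulr_ge0 (le_trans u0 uU) (le_trans v0 vV).
rewrite le_eqVlt => /predU1P[<-|UV]; first by rewrite invr0 mulr0.
by rewrite ler_pdivrMr // mul1r.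
Qed.

Lemma factor_bounds (x y : R) : 0 <= x -> x <= y -> 0 <= 1 - q `^ x <= 1 - q `^ y.
Proof. by move=> x0 xy; rewrite subr_ge0 powR_le1 // lerB // powR_anti. Qed.

Lemma a_plus_le1 n i j : - n <= i <= n -> - n <= j <= n -> `|a_plus q n i j| <= 1.
Proof.
move=> /andP[? ?] /andP[? ?]; apply: sqrt_ratio_le1.
- by rewrite powR_ge0 powR_le1 //; lra.
- by apply: factor_bounds; lra.
- by apply: factor_bounds; lra.
Qed.

Lemma a_minus_le1 n i j : - n <= i <= n -> - n <= j <= n -> `|a_minus q n i j| <= 1.
Proof.
move=> /andP[? ?] /andP[? ?]; rewrite /a_minus -[X in X / _]mul1r.
apply: sqrt_ratio_le1; first by rewrite ler01 lexx.
- by apply: factor_bounds; lra.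
- by apply: factor_bounds; lra.
Qed.

Lemma b_plus_le1 n i j : - n <= i <= n -> - n <= j <= n -> `|b_plus q n i j| <= 1.
Proof.
move=> /andP[? ?] /andP[? ?]; rewrite normrN; apply: sqrt_ratio_le1.
- by rewrite powR_ge0 powR_le1 //; lra.
- by apply: factor_bounds; lra.
- by apply: factor_bounds; lra.
Qed.

Lemma b_minus_le1 n i j : - n <= i <= n -> - n <= j <= n -> `|b_minus q n i j| <= 1.
Proof.
move=> /andP[? ?] /andP[? ?]; apply: sqrt_ratio_le1.
- by rewrite powR_ge0 powR_le1 //; lra.
- by apply: factor_bounds; lra.
- by apply: factor_bounds; lra.
Qed.

End coefficients.

(** * Weighted translations of the index *)

Section shifts.
Variable R : realType.
Implicit Types (s t : suq2_index) (dn di dj : R).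

(** The eigenvalue [2n + 1]. *)
Definition level s : R := (tag s).+1%:R.

Lemma is_index_refl s : is_index (spin R s) (row_index R s) (col_index R s) s.
Proof. by rewrite /is_index !eqxx. Qed.

Lemma index_bounds s : (- spin R s <= row_index R s <= spin R s) &&
  (- spin R s <= col_index R s <= spin R s).
Proof.
case: s => N [a b]; rewrite /row_index /col_index /spin /=.
have aN : a%:R <= N%:R :> R by rewrite ler_nat -ltnS ltn_ord.
have bN : b%:R <= N%:R :> R by rewrite ler_nat -ltnS ltn_ord.
have a0 : 0 <= a%:R :> R by []. have b0 : 0 <= b%:R :> R by [].
apply/andP; split; apply/andP; split; lra.
Qed.

(** All the operators at hand are built from translations of [(n, i, j)] by a fixed
    vector, with weights; target indices out of range give zero entries. *)
Definition shift_mx dn di dj (w : suq2_index -> R) s t : R :=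
  w s * (is_index (spin R s + dn) (row_index R s + di) (col_index R s + dj) t)%:R.

Lemma shift_mx_neq0 dn di dj w s t : shift_mx dn di dj w s t != 0 ->
  is_index (spin R s + dn) (row_index R s + di) (col_index R s + dj) t.
Proof. by rewrite /shift_mx; case: is_index => //; rewrite mulr0 eqxx. Qed.

(** A translation is injective, and a triple [(n, i, j)] determines the index. *)
Lemma shift_mx_monomial dn di dj w : monomial (shift_mx dn di dj w).
Proof.
split=> [s t t'|s s' t] /shift_mx_neq0 h /shift_mx_neq0 h'.
  exact: is_index_inj h h'.
move: h h' => /and3P[/eqP n /eqP i /eqP j] /and3P[/eqP n' /eqP i' /eqP j'].
apply: is_index_inj (is_index_refl s) _; rewrite /is_index.
have -> : spin R s' = spin R s by apply: (addIr dn); rewrite -n -n'.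
have -> : row_index R s' = row_index R s by apply: (addIr di); rewrite -i -i'.
have -> : col_index R s' = col_index R s by apply: (addIr dj); rewrite -j -j'.
by rewrite !eqxx.
Qed.

Lemma level_spin s : level s = 2 * spin R s + 1.
Proof. by rewrite /level /spin -natr1; field. Qed.

Lemma shift_mx_level dn di dj w s t : shift_mx dn di dj w s t != 0 ->
  level t = level s + 2 * dn.
Proof. by move=> /shift_mx_neq0 /and3P[/eqP h _ _]; rewrite !level_spin h; ring. Qed.

Lemma shift_mx_le1 dn di dj w s t : (forall s, `|w s| <= 1) ->
  `|shift_mx dn di dj w s t| <= 1.
Proof.
move=> w1; rewrite /shift_mx; case: is_index; first by rewrite mulr1.
by rewrite mulr0 normr0 ler01.
Qed.

(** A translation changes [2n + 1] by a constant. *)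
Lemma shift_mx_regular dn di dj w : (forall s, `|w s| <= 1) ->
  regular level (mat_op (shift_mx dn di dj w)).
Proof.
move=> w1; apply: (@mat_op_regular _ _ _ _ 1 `|2 * dn|) => //.
- exact: shift_mx_monomial.
- by move=> s t; exact: shift_mx_le1.
- by move=> s t /shift_mx_level ->; rewrite addrAC subrr add0r.
Qed.

Lemma action1E dn di dj (w : R -> R -> R -> R) :
  op_of_action (fun n i j => (w n i j)%:C%C *: Defs.basis (n + dn) (i + di) (j + dj)) =
  mat_op (shift_mx dn di dj (fun s => w (spin R s) (row_index R s) (col_index R s))).
Proof.
apply: op_of_basisE => s t; rewrite ell2ZE /= /shift_mx.
by case: is_index; rewrite ?mulr1 ?mulr0.
Qed.

Lemma action2E dn di dj dn' di' dj' (w w' : R -> R -> R -> R) :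
  op_of_action (fun n i j => (w n i j)%:C%C *: Defs.basis (n + dn) (i + di) (j + dj)
    + (w' n i j)%:C%C *: Defs.basis (n + dn') (i + di') (j + dj')) =
  mat_op (fun s t =>
    shift_mx dn di dj (fun s => w (spin R s) (row_index R s) (col_index R s)) s t +
    shift_mx dn' di' dj' (fun s => w' (spin R s) (row_index R s) (col_index R s)) s t).
Proof.
apply: op_of_basisE => s t; rewrite ell2DE !ell2ZE /= /shift_mx.
by case: is_index; case: is_index;
  rewrite ?mulr1 ?mulr0 ?addr0 ?add0r ?rmorphD.
Qed.

End shifts.

(** * The spectral triple *)

Section triple.
Variables (R : realType) (q : R) (hq0 : 0 < q) (hq1 : q < 1).

Lemma alpha_regular : regular (@level R) (alpha q).
Proof.
rewrite /alpha action2E.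
apply: mat_op_regularD; try exact: shift_mx_monomial; apply: shift_mx_regular.
  by move=> s; have /andP[? ?] := index_bounds R s; exact: a_plus_le1.
by move=> s; have /andP[? ?] := index_bounds R s; exact: a_minus_le1.
Qed.

Lemma beta_regular : regular (@level R) (beta q).
Proof.
rewrite /beta action2E.
apply: mat_op_regularD; try exact: shift_mx_monomial; apply: shift_mx_regular.
  by move=> s; have /andP[? ?] := index_bounds R s; exact: b_plus_le1.
by move=> s; have /andP[? ?] := index_bounds R s; exact: b_minus_le1.
Qed.

Lemma shift_mx_equivariant di dj w : commutes_with (diag (@level R))
  (mat_op (shift_mx 0 di dj w)) /\
  commutes_with (diag (@level R)) (op_adj (mat_op (shift_mx 0 di dj w))).
Proof.
have mm := shift_mx_monomial 0 di dj w.
have lev s t : shift_mx 0 di dj w s t != 0 -> level R s = level R t.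
  by move=> /shift_mx_level ->; rewrite mulr0 addr0.
split; first exact: mat_op_commutes.
rewrite mat_op_adj //; apply: mat_op_commutes; first exact: monomial_tr.
by move=> s t /lev.
Qed.

(** [A0] and [A1] do not change [n], so their matrices only link basis vectors
    with the same eigenvalue. *)
Lemma level_equivariant : equivariant q (diag (@level R)).
Proof.
have A0E : A0 q = mat_op (shift_mx 0 0 0 (fun s => q `^ (col_index R s))).
  rewrite -(action1E 0 0 0 (fun _ _ j => q `^ j)); congr op_of_action.
  by apply/funext => n; apply/funext => i; apply/funext => j; rewrite !addr0.
pose a1 n (i j : R) := Num.sqrt (q `^ (- 2 * n) + q `^ (2 * n + 2)
  - q `^ (- 2 * j) - q `^ (2 * j + 2)).
have A1E : A1 q = mat_op
    (shift_mx 0 0 1 (fun s => a1 (spin R s) (row_index R s) (col_index R s))).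
  rewrite -action1E; congr op_of_action.
  by apply/funext => n; apply/funext => i; apply/funext => j; rewrite !addr0.
rewrite /equivariant A0E A1E; split.
- exact: (shift_mx_equivariant _ _ _).1.
- exact: (shift_mx_equivariant _ _ _).1.
- exact: (shift_mx_equivariant _ _ _).2.
Qed.

Lemma level_ge1 s : 1 <= level R s. Proof. by rewrite ler1n. Qed.

Lemma level_gt0 s : 0 < level R s. Proof. by rewrite ltr0n. Qed.

Lemma level_ge0 s : 0 <= level R s. Proof. by rewrite ler0n. Qed.

Lemma level_pow_compact p : (0 < p)%N ->
  compact_operator (diag (fun s => (level R s ^+ p)^-1)).
Proof.
move=> p0.
have pos s : 0 <= (level R s ^+ p)^-1 by rewrite invr_ge0 exprn_ge0 ?ltW ?level_gt0.
apply: (@diag_compact _ _ _ 1) => [s|e e0].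
  by rewrite ger0_norm // invf_le1 ?exprn_gt0 ?exprn_ege1 ?level_gt0 ?level_ge1.
apply: sub_finite_set (finite_layers (Num.truncn e^-1).+1) => s /=.
rewrite ger0_norm // => es.
have le : level R s <= e^-1.
  apply: (@le_trans _ _ (level R s ^+ p)).
    by rewrite -[leLHS]expr1 ler_weXn2l ?level_ge1.
  by rewrite -[leLHS]invrK lef_pV2 ?posrE // invr_gt0 exprn_gt0 ?level_gt0.
rewrite -(ltr_nat R); apply: lt_trans (truncnS_gt e^-1).
by apply: lt_le_trans le; rewrite /level ltr_nat.
Qed.

(** From [ln (1 - x) <= - x] at [x = 1 / (N + 2)]. *)
Lemma harmonic_le_ln N : (0 < N)%N ->
  \sum_(k < N) k.+1%:R^-1 <= 1 + ln N%:R :> R.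
Proof.
case: N => // N _; elim: N => [|N IH].
  by rewrite big_ord1 invr1 ln1 addr0.
rewrite big_ord_recr /=.
apply: le_trans (lerD IH (lexx _)) _.
have N1 : 0 < N.+1%:R :> R by rewrite ltr0n.
have N2 : 0 < N.+2%:R :> R by rewrite ltr0n.
have i1 : N.+2%:R^-1 < 1 :> R by rewrite invf_lt1 // ltr1n.
have := @le_ln1Dx R (- N.+2%:R^-1); rewrite ltrN2 i1 => /(_ isT).
have -> : 1 + - N.+2%:R^-1 = N.+1%:R / N.+2%:R :> R.
  rewrite -[N.+2%:R]natr1; move: N1; move: (N.+1%:R) => a a0.
  by field; rewrite gt_eqF //; lra.
rewrite lnM ?posrE ?invr_gt0 // lnV ?posrE //.
by move: (ln _) (ln _) (N.+2%:R^-1) => a b c; lra.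
Qed.

(** In the layered enumeration, the diagonal entries decrease and are dominated by
    the harmonic sequence. *)
Lemma level_dixmier : dixmier_ideal (diag (fun s => (level R s ^+ 3)^-1)).
Proof.
split; first exact: level_pow_compact.
have [e [eK Ke]] := rank_enum.
have l0 s : 0 < level R s ^+ 3 by rewrite exprn_gt0 ?level_gt0.
exists (fun k => (level R (e k) ^+ 3)^-1).
  split=> [k|].
    rewrite lef_pV2 ?posrE // ler_pXn2r ?nnegrE ?level_ge0 //.
    by rewrite /level ler_nat ltnS; apply: rank_tag; rewrite !eK.
  exists (diag (fun s => (level R s ^+ 3)^-1)), (fun k => delta R (e k)); split.
  - by apply: diag_is_abs => s; rewrite invr_ge0 ltW.
  - move=> k l; rewrite inner_delta_l /= conjc_nat.
    by rewrite -(inj_eq (can_inj eK)).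
  - by move=> k; exact: (diag_delta (fun s => (level R s ^+ 3)^-1)).
  - move=> x xe; apply/diagP => t; rewrite ell20E -[t]Ke.
    by rewrite -(inner_delta_r (e (rank t)) x) xe mulr0.
(* For [2 <= N], the bound [1 + ln N] is at most [(1 + 1 / ln 2) * ln N]. *)
apply/eqO_exP; exists (1 + (ln 2)^-1).
  by rewrite addr_gt0 // invr_gt0 ln_gt0 // ltr1n.
exists 2 => // N /= N2.
have ln2 : 0 < ln 2 :> R by rewrite ln_gt0 // ltr1n.
have lnN : ln 2 <= ln N%:R :> R by rewrite ler_ln ?posrE ?ltr0n ?ler_nat // (leq_trans _ N2).
rewrite ger0_norm; last by apply: sumr_ge0 => k _; rewrite invr_ge0 ltW.
rewrite ger0_norm; last by apply: le_trans lnN; exact: ltW.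
apply: (@le_trans _ _ (1 + ln N%:R)).
  apply: le_trans (harmonic_le_ln (leq_trans _ N2)) => //.
  apply: ler_sum => k _; rewrite lef_pV2 ?posrE ?ltr0n //.
  rewrite /level -natrX ler_nat; have := rank_cube (e k); by rewrite eK.
rewrite mulrDl mul1r addrC lerD2l mulrC ler_pdivlMr // mul1r.
exact: lnN.
Qed.

Lemma level_summable : p_summable 3 (diag (@level R)).
Proof.
have n1 s : 1 <= `|level R s| by rewrite ger0_norm ?level_ge1 ?level_ge0.
exists (diag (@level R)).
  by apply: diag_is_abs => s; exact: level_ge0.
have -> : op_pow (diag (@level R)) 3 = diag (fun s => level R s ^+ 3).
  rewrite /op_pow /=.
  have -> : @op_id R suq2_index = diag (fun=> 1).
    apply/seteqP; split=> -[x y].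
      by move=> yx; have {}yx : y = x := yx; apply/diagP => t; rewrite yx mul1r.
    by move/diagP => yx; apply: ell2_ext => t; rewrite yx mul1r.
  rewrite !diag_comp //; apply: eq_diag => s; ring.
rewrite diag_inv_off_ker; last by move=> s; rewrite expf_neq0 // gt_eqF // level_gt0.
exact: level_dixmier.
Qed.

Lemma level_spectral_triple :
  odd_spectral_triple (suq2_polynomials q) (diag (@level R)).
Proof.
split; first exact: diag_self_adjoint.
  have h : compact_operator (resolvent (diag (@level R)) 0).
    rewrite diag_resolvent0 => [|s]; last by rewrite gt_eqF // level_gt0.
    exact: (@level_pow_compact 1).
  by exists 0 => //; exact: h.1.
move=> T TA; apply: regular_commutator; apply: regular_star TA.
by move=> _ [->|->]; [exact: alpha_regular | exact: beta_regular].
Qed.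

End triple.

Theorem theorem3p5 (R : realType) (q : R) (hq0 : 0 < q) (hq1 : q < 1) :
  exists D : graph R suq2_index,
    [/\ equivariant q D,
        odd_spectral_triple (suq2_polynomials q) D &
        p_summable 3 D].
Proof.
exists (diag (@level R)); split.
- exact: level_equivariant.
- exact: level_spectral_triple.
- exact: level_summable.
Qed.
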